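(* Let $p\in(0,1]$, $h=p/(1+p)$, $\lambda>0$, and let $h<\rho<1/2$ be fixed. Consider, for each $n$, the TASEP-H process with A-perturbations on $n$ sites with $\rho n$ particles and parameter $\lambda$, and its scaled state descriptors $[f^n(\cdot,t),\ell^n(t),r^n(t),\tau^n(t)]$. Then, as $n\to\infty$, any subsequential weak limit of the sequence of stationary distributions of $[f^n(\cdot,t),\ell^n(t),r^n(t),\tau^n(t)]$ is a distribution concentrated on the main equilibrium states. Consequently, the limiting flux (typical flux) is $\phi(\rho)=\lim_{n\to\infty}\phi(\rho,n)=\phi^*$, where $\phi^*=(1-\tau^* )h=p(1-\rho)$ and $\tau^*=\frac{\rho-h}{1-h}$.
   Context: Basic dynamics (TASEP-H). There are $n$ sites $0,1,\dots,n-1$ arranged in a circle (clockwise = ''right'') and a constant number $\rho n$ of particles (assumed an integer; otherwise use $\lceil\rho n\rceil$), at most one per site; empty sites are called holes. Time is discrete, $t=0,1,2,\dots$. Given the state at time $t$, the state at $t+1$ is obtained by applying to each particle simultaneously and independently: (a) if its right-neighbor site is occupied, it does not move; (b) if both neighbor sites are holes, it moves one site right with probability $1$; (c) if the right-neighbor site is a hole and the left-neighbor site is occupied, it moves one site right with probability $p$. A particle is free if both neighbor sites are holes. A cluster is a maximal contiguous set of at least two particles. A state is ideal if it contains no clusters. Perturbation. A perturbation of a state: a particle chosen uniformly at random is removed (its site immediately becoming a hole), and is then placed into one of the holes chosen uniformly at random (possibly the same site). A-perturbations model with parameter $\lambda>0$: at each time $t$ such that the state after the normal particle movement at time $t$ is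 ideal, one perturbation is applied with probability $\lambda/n$, independently of the past; it takes no extra time, and the state at time $t$ is the state after movement and after the perturbation, if any. The state space is restricted to states reachable from a state in which all particles are in one cluster; on it the chain is irreducible, and every state has at most one cluster. Flux. For a state $\overline Z$, $\phi(\rho,n;\overline Z)=\psi(\rho,n;\overline Z)/n$, where $\psi(\rho,n;\overline Z)$ is the expected total distance traveled by all particles in the next time step when the current state is $\overline Z$ (a particle relocated by a perturbation is considered to travel clockwise to its new site). The flux is $\phi(\rho,n)=\mathbb{E}\,\phi(\rho,n;\overline Z(\infty))$ with $\overline Z(\infty)$ distributed according to the stationary distribution. The limiting (typical) flux is $\phi(\rho)=\lim_{n\to\infty}\phi(\rho,n)$, with $\rho,\lambda,p$ fixed. Scaled state. Space, time and particle numbers are divided by $n$; scaled time $t$ corresponds to unscaled time $\lfloor nt\rfloor$. Only increments of $f^n(\cdot,t)$ matter; in the standard version, $f^n(x,t)$ for $x\in[0,1)$ is $1/n$ times the number of particles in sites $1,\dots,\lfloor nx\rfloor$ (so $f^n(0,t)=0$), extended to $x\in\mathbb{R}$ by $f^n(x+1,t)=f^n(x,t)+\rho$. If a cluster exists at time $t$, $\ell^n(t)$ and $r^n(t)$ are the scaled locations (site number divided by $n$) of its leftmost and rightmost particles, with (standard version) $\ell^n(t)\in[0,1)$ and $r^n(t)\ge\ell^n(t)$ measured clockwise from $\ell^n(t)$, and $\tau^n(t)=r^n(t)-\ell^n(t)$ (so the cluster has $n\tau^n(t)+1$ particles). If no cluster exists, $\tau^n(t)=0$ and $\ell^n(t)=r^n(t)$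 is frozen at the value of $\ell^n$ at the last time a cluster existed (or $0$ if none existed before). The metric on states is the sum of: the sup-norm distance for $f$; $|\tau_1-\tau_2|$ for $\tau$; and the unit-circle distance $\min_{k\in\mathbb{Z}}|\ell_1-\ell_2+k|$ for $\ell$, and similarly for $r$. Main equilibrium state (MES), for $h<\rho<1$: a state $[f^*(\cdot),\ell^*,r^*,\tau^*]$ such that $\tau^*=\frac{\rho-h}{1-h}$, $r^*=\ell^*+\tau^*$, $(f^* )'(x)=1$ for $x\in(\ell^*,r^* )$, and $(f^* )'(x)=h$ for $x\in(r^*,\ell^*+1)$ (with $f^*$ continuous and $f^*(x+1)-f^*(x)=\rho$). It is unique up to a space shift of the cluster. *)

(* Defs.v *)
From HB Require Import structures.
From mathcomp Require Import all_boot all_order all_algebra.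
From mathcomp Require Import all_classical all_reals all_analysis.
Set Implicit Arguments.
Unset Strict Implicit.
Unset Printing Implicit Defensive.
Import Order.TTheory GRing.Theory Num.Theory.
Import numFieldNormedType.Exports.
Local Open Scope classical_set_scope.
Local Open Scope ring_scope.

(* A configuration is the set of occupied sites; ordS i is the right neighbor
   (clockwise) of the site i on the circle 'I_n, ord_pred i its left neighbor. *)
Notation config n := {set 'I_n}.

Section Dynamics.
Variables (R : realType) (n : nat).
Implicit Types (eta M : config n) (i a b s : 'I_n) (c : 'I_n * 'I_n).

(* c = (i, k): the k sites i, i+1, ..., i+k-1 are occupied, k >= 2, and the arc
   is maximal, i.e. i-1 and i+k are holes.  k ranges over 'I_n because the arc
   misses at least one site (the fully occupied circle, which has no leftmost
   particle, is not considered). *)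
Definition is_cluster eta c : bool :=
  [&& (1 < c.2)%N,
      [forall j : 'I_n, (j < c.2)%N ==> (iter j (@ordS n) c.1 \in eta)],
      ord_pred c.1 \notin eta & iter c.2 (@ordS n) c.1 \notin eta].

Definition ideal eta : bool := ~~ [exists c, is_cluster eta c].

Definition jump_prob (p : R) eta i : R :=
  if (i \in eta) && (ordS i \notin eta)
  then (if ord_pred i \in eta then p else 1) else 0.

(* Probability that M is exactly the set of (initial) sites of the particles
   that move, the particles moving independently. *)
Definition movers_prob (p : R) eta M : R :=
  \prod_(i : 'I_n) (if i \in M then jump_prob p eta i else 1 - jump_prob p eta i).

Definition moved eta M : config n := (eta :\: M) :|: [set ordS i | i in M].

Definition relocated eta a b : config n := b |: (eta :\ a).

Definition cw_dist a b : nat := (b + (n - a)) %% n.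

Definition pert_prob (lambda : R) eta : R :=
  if ideal eta then lambda / n%:R else 0.

(* Expectation of F (state at time t+1) (total distance traveled in the step)
   when the state at time t is eta.  Given the state e after the movement, a
   perturbation takes a uniformly chosen particle a to a uniformly chosen hole
   b of e :\ a (b = a is allowed). *)
Definition step_mean (p lambda : R) eta (F : config n -> nat -> R) : R :=
  \sum_(M : config n) movers_prob p eta M *
    (let e := moved eta M in
     let d := #|M| in
     let holes a := ~: (e :\ a) in
     (1 - pert_prob lambda e) * F e d +
     pert_prob lambda e *
       ((\sum_(a in e)
           (\sum_(b in holes a) F (relocated e a b) (d + cw_dist a b)%N)
             / #|holes a|%:R)
        / #|e|%:R)).

Definition trans_prob (p lambda : R) eta eta' : R :=
  step_mean p lambda eta (fun e _ => (e == eta')%:R).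

Definition mean_distance (p lambda : R) eta : R :=
  step_mean p lambda eta (fun _ d => d%:R).

Definition left_site eta s : 'I_n :=
  if [pick c | is_cluster eta c] is Some c then c.1 else s.

Definition cluster_span eta : nat :=
  if [pick c | is_cluster eta c] is Some c then c.2.-1 else 0.

(* The scaled descriptors depend on the configuration and, when there is no
   cluster, on the site of the leftmost particle of the last cluster.  Hence
   they are functions of the Markov chain with states (eta, s), where s is that
   site (the leftmost site of the current cluster if there is one). *)
Definition trans_prob_ext (p lambda : R) (z z' : config n * 'I_n) : R :=
  trans_prob p lambda z.1 z'.1 * (z'.2 == left_site z'.1 z.2)%:R.

Definition one_cluster (m : nat) eta : bool :=
  (#|eta| == m) && [exists c, is_cluster eta c && (c.2 == m :> nat)].

Definition one_cluster_ext (m : nat) (z : config n * 'I_n) : bool :=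
  one_cluster m z.1 && (z.2 == left_site z.1 z.2).

End Dynamics.

(* pi is a stationary distribution of the finite Markov chain with transition
   probabilities K, restricted to the states reachable from a state in A. *)
Definition stationary (R : realType) (T : finType) (K : T -> T -> R)
    (A : pred T) (pi : T -> R) : Prop :=
  [/\ forall z, 0 <= pi z,
      \sum_z pi z = 1,
      forall z, pi z != 0 ->
        exists2 z0, A z0 & connect [rel u v | 0 < K u v] z0 z
    & forall z', \sum_z pi z * K z z' = pi z'].

Definition nparticles (R : realType) (rho : R) (n : nat) : nat :=
  absz (Num.ceil (rho * n%:R)).

Definition tasep_stationary (R : realType) (p lambda rho : R) (n : nat)
    (nu : config n -> R) : Prop :=
  stationary (trans_prob p lambda) (one_cluster (nparticles rho n)) nu.

Definition tasep_stationary_ext (R : realType) (p lambda rho : R) (n : nat)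
    (pi : config n * 'I_n -> R) : Prop :=
  stationary (trans_prob_ext p lambda) (one_cluster_ext (nparticles rho n)) pi.

Definition flux (R : realType) (p lambda : R) (n : nat)
    (nu : config n -> R) : R :=
  \sum_eta nu eta * (mean_distance p lambda eta / n%:R).

(* Scaled states [f, l, r, tau] in the standard version.  Boundedness of f makes
   the sup-norm distance finite. *)
Record sstate (R : realType) (rho : R) := SState {
  ss_f : R -> R ;
  ss_l : R ;
  ss_r : R ;
  ss_tau : R ;
  ss_f0 : ss_f 0 = 0 ;
  ss_fD1 : forall x, ss_f (x + 1) = ss_f x + rho ;
  ss_fbnd : exists C : R, forall x, 0 <= x < 1 -> `|ss_f x| <= C ;
  ss_l01 : 0 <= ss_l < 1 ;
  ss_lr : ss_l <= ss_r ;
  ss_tauE : ss_tau = ss_r - ss_l }.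

Definition sup_dist (R : realType) (f g : R -> R) : R :=
  sup [set `|f x - g x| | x in [set: R]].

Definition circle_dist (R : realType) (a b : R) : R :=
  inf [set `|a - b + k%:~R| | k in [set: int]].

Definition ss_dist (R : realType) (rho : R) (z1 z2 : sstate rho) : R :=
  sup_dist (ss_f z1) (ss_f z2) + `|ss_tau z1 - ss_tau z2|
  + circle_dist (ss_l z1) (ss_l z2) + circle_dist (ss_r z1) (ss_r z2).

Section Metric.
Variables (R : realType) (rho : R).
Implicit Types (z : sstate rho) (a b c : R).

Lemma ss_fDz z (k : int) x : ss_f z (x + k%:~R) = ss_f z x + k%:~R * rho.
Proof.
have Hn (m : nat) y : ss_f z (y + m%:R) = ss_f z y + m%:R * rho.
  elim: m => [|m IH]; first by rewrite addr0 mul0r addr0.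
  by rewrite -natr1 addrA ss_fD1 IH mulrDl mul1r addrA.
case: k => m; first exact: Hn.
rewrite NegzE mulrNz -pmulrn mulNr.
by rewrite -[in RHS](subrK m.+1%:R x) Hn addrK.
Qed.

Lemma sup_dist_has z1 z2 :
  has_sup [set `|ss_f z1 x - ss_f z2 x| | x in [set: R]].
Proof.
split; first by exists `|ss_f z1 0 - ss_f z2 0|, 0.
have [C1 H1] := ss_fbnd z1; have [C2 H2] := ss_fbnd z2.
exists (C1 + C2) => _ [x _ <-].
set y := x - (Num.floor x)%:~R.
have y01 : 0 <= y < 1.
  have /andP[h1 h2] := floor_itv x.
  by rewrite /y subr_ge0 h1 ltrBlDr addrC -intrD1.
have -> : ss_f z1 x - ss_f z2 x = ss_f z1 y - ss_f z2 y.
  have fxy z : ss_f z x = ss_f z y + (Num.floor x)%:~R * rho.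
    by rewrite -ss_fDz subrK.
  by rewrite !fxy opprD addrACA subrr addr0.
by rewrite (le_trans (ler_normB _ _))// lerD ?H1 ?H2.
Qed.

Lemma sup_dist_ub z1 z2 x :
  `|ss_f z1 x - ss_f z2 x| <= sup_dist (ss_f z1) (ss_f z2).
Proof.
by apply: ub_le_sup; [case: (sup_dist_has z1 z2)|exists x].
Qed.

Lemma sup_dist_ge0 z1 z2 : 0 <= sup_dist (ss_f z1) (ss_f z2).
Proof. exact: le_trans (normr_ge0 _) (sup_dist_ub z1 z2 0). Qed.

Lemma circle_dist_has a b :
  has_inf [set `|a - b + k%:~R| | k in [set: int]].
Proof.
by split; [exists `|a - b + 0%:~R|, 0|exists 0 => _ [k _ <-]].
Qed.

Lemma circle_dist_lb a b (k : int) : circle_dist a b <= `|a - b + k%:~R|.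
Proof. by apply: ge_inf; [case: (circle_dist_has a b)|exists k]. Qed.

Lemma circle_dist_ge0 a b : 0 <= circle_dist a b.
Proof.
by apply: lb_le_inf; [case: (circle_dist_has a b)|move=> _ [k _ <-]].
Qed.

Lemma circle_distxx a : circle_dist a a = 0.
Proof.
apply/eqP; rewrite eq_le circle_dist_ge0 andbT.
by have := circle_dist_lb a a 0; rewrite subrr addr0 normr0.
Qed.

Lemma circle_dist_le_sym a b : circle_dist a b <= circle_dist b a.
Proof.
apply: lb_le_inf; first by case: (circle_dist_has b a).
move=> _ [k _ <-]; have := circle_dist_lb a b (- k).
by rewrite mulrNz -(opprB b a) -opprD normrN.
Qed.

Lemma circle_dist_triangle b a c :
  circle_dist a c <= circle_dist a b + circle_dist b c.
Proof.
rewrite -lerBlDr; apply: lb_le_inf; first by case: (circle_dist_has a b).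
move=> _ [k _ <-]; rewrite lerBlDl -lerBlDr.
apply: lb_le_inf; first by case: (circle_dist_has b c).
move=> _ [j _ <-]; rewrite lerBlDr.
apply: le_trans (circle_dist_lb a c (j + k)) _.
rewrite -[a - c](subrKA b) intrD [j%:~R + _]addrC addrACA addrC.
by rewrite ler_normD.
Qed.

Lemma circle_dist0 a b : 0 <= a < 1 -> 0 <= b < 1 ->
  circle_dist a b = 0 -> a = b.
Proof.
move=> /andP[a0 a1] /andP[b0 b1] ab0; apply/eqP; rewrite -subr_eq0.
apply: contraT => nz.
have d1 : `|a - b| < 1.
  by rewrite ltr_norml ltrBrDr ltrBlDr; apply/andP; split;
    [rewrite (lt_le_trans _ a0)// addrC subr_lt0|
     rewrite (lt_le_trans a1)// lerDl].
suff : Num.min `|a - b| (1 - `|a - b|) <= circle_dist a b.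
  by rewrite ab0 ge_min normr_le0 (negbTE nz) subr_le0 leNgt d1.
apply: lb_le_inf; first by case: (circle_dist_has a b).
move=> _ [k _ <-]; rewrite ge_min.
have [->|k0] := eqVneq k 0; first by rewrite addr0 lexx.
apply/orP; right.
have k1 : 1 <= `|k%:~R : R|.
  by rewrite -intr_norm -[1]/(1%:~R) ler_int -gtz0_ge1 normr_gt0.
rewrite lerBlDl (le_trans k1)//.
by rewrite -[X in `|X|](addKr (a - b)) -(normrN (a - b)) ler_normD.
Qed.

Lemma ss_distxx z : ss_dist z z = 0.
Proof.
rewrite /ss_dist !circle_distxx subrr normr0 !addr0 /sup_dist.
rewrite (_ : [set _ | _ in _] = [set 0]) ?sup1//.
apply/seteqP; split=> [_ [x _ <-]|_ ->] /=; first by rewrite subrr normr0.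
by exists 0 => //; rewrite subrr normr0.
Qed.

Lemma sstate_eq z1 z2 : ss_f z1 = ss_f z2 -> ss_l z1 = ss_l z2 ->
  ss_tau z1 = ss_tau z2 -> z1 = z2.
Proof.
case: z1 => f1 l1 r1 t1 a1 b1 c1 d1 g1 e1.
case: z2 => f2 l2 r2 t2 a2 b2 c2 d2 g2 e2 /=.
move=> ef el et.
have er : r1 = r2.
  by rewrite -(subrK l1 r1) -e1 et e2 el subrK.
move: a2 b2 c2 d2 g2 e2; rewrite -ef -el -et -er => a2 b2 c2 d2 g2 e2.
by rewrite (Prop_irrelevance a1 a2) (Prop_irrelevance b1 b2)
  (Prop_irrelevance c1 c2) (Prop_irrelevance d1 d2) (Prop_irrelevance g1 g2)
  (Prop_irrelevance e1 e2).
Qed.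

Lemma ss_dist_positivity z1 z2 : ss_dist z1 z2 = 0 -> z1 = z2.
Proof.
have s0 := sup_dist_ge0 z1 z2.
have t0 := normr_ge0 (ss_tau z1 - ss_tau z2).
have l0 := circle_dist_ge0 (ss_l z1) (ss_l z2).
have r0 := circle_dist_ge0 (ss_r z1) (ss_r z2).
move=> /eqP; rewrite /ss_dist !paddr_eq0 ?addr_ge0//.
move=> /andP[/andP[/andP[/eqP fe te] /eqP le] _].
apply: sstate_eq.
- apply/funext => x; apply/eqP; rewrite -subr_eq0 -normr_le0 -fe.
  exact: sup_dist_ub.
- exact: circle_dist0 (ss_l01 z1) (ss_l01 z2) le.
- by apply/eqP; rewrite -subr_eq0 -normr_eq0.
Qed.

Lemma sup_dist_sym (f g : R -> R) : sup_dist f g = sup_dist g f.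
Proof.
by rewrite /sup_dist; congr sup; apply/seteqP; split=> _ [x _ <-];
  exists x => //; rewrite distrC.
Qed.

Lemma ss_dist_sym z1 z2 : ss_dist z1 z2 = ss_dist z2 z1.
Proof.
have cs a b : circle_dist a b = circle_dist b a.
  by apply/eqP; rewrite eq_le !circle_dist_le_sym.
by rewrite /ss_dist sup_dist_sym distrC (cs (ss_l z1)) (cs (ss_r z1)).
Qed.

Lemma ss_dist_triangle z2 z1 z3 :
  ss_dist z1 z3 <= ss_dist z1 z2 + ss_dist z2 z3.
Proof.
have sD : sup_dist (ss_f z1) (ss_f z3) <=
    sup_dist (ss_f z1) (ss_f z2) + sup_dist (ss_f z2) (ss_f z3).
  apply: ge_sup; first by case: (sup_dist_has z1 z3).
  move=> _ [x _ <-]; apply: le_trans (ler_distD (ss_f z2 x) _ _) _.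
  by rewrite lerD ?sup_dist_ub.
rewrite /ss_dist [leRHS]addrACA lerD ?circle_dist_triangle//.
rewrite [leRHS]addrACA lerD ?circle_dist_triangle//.
by rewrite [leRHS]addrACA lerD// ler_distD.
Qed.

Lemma floor_f0 : (Num.floor (0 : R))%:~R * rho = 0.
Proof. by rewrite floor0 mul0r. Qed.

Lemma floor_fD1 (x : R) :
  (Num.floor (x + 1))%:~R * rho = (Num.floor x)%:~R * rho + rho.
Proof.
by rewrite -[X in x + X]/(1%:~R) floorDrz ?intr_int// intrKfloor intrD mulrDl mul1r.
Qed.

Lemma floor_fbnd :
  exists C : R, forall x : R, 0 <= x < 1 -> `|(Num.floor x)%:~R * rho| <= C.
Proof.
exists 0 => x /andP[x0 x1]; have -> : Num.floor x = 0; last by rewrite mul0r normr0.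
by apply/eqP; rewrite floor_eq x0.
Qed.

Definition ss_point : sstate rho.
Proof.
refine (@SState R rho (fun x => (Num.floor x)%:~R * rho) 0 0 0
  floor_f0 floor_fD1 floor_fbnd _ _ _).
- by rewrite lexx ltr01.
- exact: lexx.
- by rewrite subrr.
Defined.

End Metric.

HB.instance Definition _ (R : realType) (rho : R) :=
  gen_eqMixin (sstate rho).
HB.instance Definition _ (R : realType) (rho : R) :=
  gen_choiceMixin (sstate rho).
HB.instance Definition _ (R : realType) (rho : R) :=
  isPointed.Build (sstate rho) (ss_point rho).
HB.instance Definition _ (R : realType) (rho : R) :=
  @isMetric.Build R (sstate rho) (@ss_dist R rho) (@ss_distxx R rho)
    (@ss_dist_positivity R rho) (@ss_dist_sym R rho) (@ss_dist_triangle R rho).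

Notation borel T := (g_sigma_algebraType (@open T)).

(* The standard version of f^n.  If rho * n is not an integer, f^n(x + 1) - f^n(x)
   is still exactly rho; this differs by less than 1/n from the scaled number
   of particles. *)
Definition profile (R : realType) (rho : R) (n : nat) (eta : config n)
    (x : R) : R :=
  let k := Num.floor x in
  #|[set i in eta | (1 <= i <= Num.truncn (n%:R * (x - k%:~R)))%N]|%:R / n%:R
  + k%:~R * rho.

Section Scaled.
Variables (R : realType) (rho : R) (n : nat).
Implicit Types (eta : config n) (s : 'I_n).

Lemma profile0 eta : profile rho eta 0 = 0.
Proof.
rewrite /profile floor0 mul0r addr0 subrr mulr0 truncn0.
rewrite (_ : [set i in eta | _] = finset.set0) ?cards0 ?mul0r//.
by apply/setP => i; rewrite !inE; case: (i : nat) => [|m]; rewrite andbF.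
Qed.

Lemma profileD1 eta x : profile rho eta (x + 1) = profile rho eta x + rho.
Proof.
have -> : x + 1 = x + 1%:~R by [].
rewrite /profile floorDrz ?intr_int// intrKfloor intrD mulrDl mul1r addrA.
by congr (#|_|%:R / _ + _ + _); rewrite opprD addrACA subrr addr0.
Qed.

Lemma profile_bnd eta :
  exists C : R, forall x, 0 <= x < 1 -> `|profile rho eta x| <= C.
Proof.
exists (n%:R / n%:R) => x /andP[x0 x1]; rewrite /profile.
have -> : Num.floor x = 0 by apply/eqP; rewrite floor_eq x0.
rewrite mul0r addr0 ger0_norm ?divr_ge0// ler_wpM2r ?invr_ge0// ler_nat.
by rewrite -[leqRHS]card_ord max_card.
Qed.

Let lsite eta s : R := (left_site eta s)%:R / n%:R.
Let tau eta : R := (cluster_span eta)%:R / n%:R.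

Lemma lsite01 eta s : 0 <= lsite eta s < 1.
Proof.
have n0 : (0 < n)%N by exact: leq_ltn_trans (ltn_ord s).
by rewrite divr_ge0//= ltr_pdivrMr ?ltr0n// mul1r ltr_nat.
Qed.

Lemma lsite_le eta s : lsite eta s <= lsite eta s + tau eta.
Proof. by rewrite lerDl divr_ge0. Qed.

Lemma tauE eta s : tau eta = lsite eta s + tau eta - lsite eta s.
Proof. by rewrite addrAC subrr add0r. Qed.

Definition scaled (z : config n * 'I_n) : sstate rho :=
  @SState R rho (profile rho z.1)
    ((left_site z.1 z.2)%:R / n%:R)
    ((left_site z.1 z.2)%:R / n%:R + (cluster_span z.1)%:R / n%:R)
    ((cluster_span z.1)%:R / n%:R)
    (profile0 z.1) (@profileD1 z.1) (profile_bnd z.1)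
    (lsite01 z.1 z.2) (lsite_le z.1 z.2) (tauE z.1 z.2).

End Scaled.

(* Weak convergence, as j tends to infinity, of the laws of the scaled state
   under pi (k j) to mu; these laws have finite support, so the integrals of g
   against them are finite sums. *)
Definition weak_limit (R : realType) (rho : R)
    (pi : forall n, config n * 'I_n -> R) (k : nat -> nat)
    (mu : probability (borel (sstate rho)) R) : Prop :=
  forall g : sstate rho -> R,
    continuous g -> (exists C : R, forall z, `|g z| <= C) ->
    (fun j => (\sum_z pi (k j) z * g (scaled rho z))%:E) @ \oo -->
      (\int[mu]_z (g z)%:E)%E.

Definition tau_star (R : realType) (h rho : R) : R := (rho - h) / (1 - h).

Definition main_equilibrium (R : realType) (h rho : R) : set (sstate rho) :=
  [set z | [/\ ss_tau z = tau_star h rho,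
               ss_r z = ss_l z + ss_tau z,
               continuous (ss_f z),
               forall x : R, ss_l z < x < ss_r z ->
                 is_derive x (1 : R) (ss_f z) (1 : R)
             & forall x : R, ss_r z < x < ss_l z + 1 ->
                 is_derive x (1 : R) (ss_f z) h]].
Arguments main_equilibrium {R} h rho.

(* Main.v *)
Require Import Defs.
From mathcomp Require Import all_boot all_order all_algebra.
From mathcomp Require Import all_classical all_reals all_analysis.
From mathcomp Require Import zify ring lra.
Import Order.TTheory GRing.Theory Num.Theory.
Import numFieldNormedType.Exports.
Set Implicit Arguments.
Unset Strict Implicit.
Unset Printing Implicit Defensive.

(* Cut the circle at the holes: a state with one cluster becomes a circle of N
   boxes, one per hole, all holding 0 or 1 particle except the box of the cluster.
   In the frame of the free particles the cluster moves one box per step, swallows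
   the content of the next box and leaves a Bernoulli(p) particle behind.  Hence,
   once the cluster has survived one round of L = N - 1 steps, the boxes hold
   independent Bernoulli(p) bits, and Chernoff's bound puts the state within o(n)
   of a main equilibrium state up to an exponentially small probability.  As
   rho > h means that the density of particles per box exceeds p, there are states
   of this kind only with a macroscopic cluster, so old clusters dissolve at an
   exponentially small rate.  In equilibrium this rate equals the rate of births of
   clusters that survive a round; by the cycle lemma and an exponential
   supermartingale, that rate is at least a constant times n^-3 times the
   probability of an ideal state.  So ideal states and young clusters have vanishing
   probability.  Weak limits are then tested on the bounded continuous function
   min(1, dist(z, z')), where z' is the main equilibrium state with the cluster
   location of z. *)

(** * Words and configurations on the circle *)

(** Conditioning on survival would bias the bits that the cluster leaves behind. Survival is
    therefore encoded in the sub-Markov kernel [move_nonideal], which kills the chain as soon as a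
    movement ends in an ideal state; iterated [k] times on the constant 1 it gives the probability
    of surviving [k] steps. Killing only lowers the mean of a nonnegative function, so every upper
    bound can be computed with unconditioned independent bits. Only the births need a lower bound,
    and a polynomial one suffices against an exponentially small death rate. Its [n^-3] pays for one
    favourable relocation: a factor [1/n] each for the perturbation, the particle and the hole. The
    obstacle is that a new pair may first meet a long stretch of empty boxes and dissolve. The cycle
    lemma provides a place from which every initial stretch of boxes has the average density up to a
    deficit of one particle. As this density exceeds [p], the cluster then survives with probability
    bounded below uniformly in [n]. *)

Definition box (b : bool) : bitseq := if b then [:: false; true] else [:: false].
Definition boxes (bs : bitseq) : bitseq := flatten (map box bs).

Lemma boxes_cons b bs : boxes (b :: bs) = box b ++ boxes bs.
Proof. by []. Qed.

Lemma boxes_cat bs1 bs2 : boxes (bs1 ++ bs2) = boxes bs1 ++ boxes bs2.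
Proof. by rewrite /boxes map_cat flatten_cat. Qed.

Lemma boxes_nseq k : boxes (nseq k false) = nseq k false.
Proof. by elim: k => //= k; rewrite boxes_cons => ->. Qed.

Lemma size_boxes bs : size (boxes bs) = size bs + count id bs.
Proof.
by elim: bs => // -[] bs IH; rewrite boxes_cons size_cat IH /=; lia.
Qed.

Lemma count_boxes bs : count id (boxes bs) = count id bs.
Proof. by elim: bs => // -[] bs IH; rewrite boxes_cons count_cat IH. Qed.

Definition nadj (a b : bool) := ~~ (a && b).

Lemma boxes_sorted bs : sorted nadj (boxes bs ++ [:: false]).
Proof.
elim: bs => // b bs IH; rewrite boxes_cons -catA.
have : path nadj false (boxes bs ++ [:: false]).
  by case: (boxes bs) IH => //= x s.
case: b => // H; apply/andP; split=> //.
by case: bs H {IH} => // -[] bs /andP[_ H]; apply/andP.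
Qed.

(** Peeling off [01] or [0] leaves a word that starts with a hole again, because no two particles
    are adjacent. *)
Lemma boxes_parse v : v != [::] -> head false v = false -> last false v = false ->
  sorted nadj v -> exists bs, v = boxes bs ++ [:: false].
Proof.
have [k] := ubnP (size v); elim: k v => // k IH v; rewrite ltnS.
case: v => // -[] // [|[] v] // sv _ _ /= lv.
- by exists [::].
- case: v sv lv => // -[] // v sv lv pv.
  have [bs E] : exists bs, false :: v = boxes bs ++ [:: false].
    by apply: IH => //; move: sv => /=; lia.
  by exists (true :: bs); rewrite E.
- move=> pv; have [bs E] : exists bs, false :: v = boxes bs ++ [:: false].
    by apply: IH => //; move: sv => /=; lia.
  by exists (false :: bs); rewrite E.
Qed.

(* The prefix of length [s] may cut a box [01] in two; [e] repairs that. *)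
Lemma boxes_take bs s : s <= size (boxes bs) ->
  exists j e, [/\ j <= size bs, e <= 1,
    count id (take s (boxes bs)) + e = count id (take j bs) &
    s + e = j + count id (take j bs)].
Proof.
elim: bs s => [|b bs IH] s; first by rewrite leqn0 => /eqP ->; exists 0, 0.
rewrite boxes_cons size_cat => sb.
have [-> | s0] := posnP s; first by exists 0, 0; rewrite take0.
have [s1 | s1] := leqP (size (box b)) s.
  have [|j [e [H1 H2 H3 H4]]] := IH (s - size (box b)); first by lia.
  exists j.+1, e; rewrite take_cat ifN -?leqNgt // count_cat -addnA H3.
  have -> : count id (box b) = b by case: (b).
  split=> //; case: b s1 H4 {sb H3} => /=; lia.
case: b s1 sb => /= s1 sb; last by lia.
have -> : s = 1 by lia.
by exists 1, 1; rewrite /= !take0; split.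
Qed.

Section Conf.
Variable n : nat.
Implicit Types (l i : 'I_n) (w : bitseq) (A : config n).

Definition site l k : 'I_n := iter k (@ordS n) l.

Lemma val_site l k : site l k = (l + k) %% n :> nat.
Proof.
elim: k => [|k IH] /=; first by rewrite addn0 modn_small.
by rewrite IH -addn1 modnDml addn1 addnS.
Qed.

Lemma cw_dist_lt l i : cw_dist l i < n.
Proof. by rewrite ltn_mod (leq_ltn_trans _ (ltn_ord l)). Qed.

Lemma cw_dist_site l k : k < n -> cw_dist l (site l k) = k.
Proof.
move=> kn; rewrite /cw_dist val_site modnDml.
have -> : l + k + (n - l) = k + n by have := ltn_ord l; lia.
by rewrite modnDr modn_small.
Qed.

Lemma site_cw_dist l i : site l (cw_dist l i) = i.
Proof.
apply: val_inj => /=; rewrite val_site /cw_dist modnDmr.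
have -> : l + (i + (n - l)) = i + n by have := ltn_ord l; lia.
by rewrite modnDr modn_small.
Qed.

Lemma ordS_site l k : ordS (site l k) = site l k.+1.
Proof. by []. Qed.

Lemma site_n l : site l n = l.
Proof. by apply: val_inj; rewrite /= val_site modnDr modn_small. Qed.

Lemma ord_pred_siteS l k : ord_pred (site l k.+1) = site l k.
Proof. by rewrite /site /= ordSK. Qed.

Lemma ord_pred_site0 l : ord_pred l = site l n.-1.
Proof.
have n0 : 0 < n by exact: leq_ltn_trans (ltn_ord l).
by have := ord_pred_siteS l n.-1; rewrite prednK // site_n.
Qed.

Lemma site_inj l j k : j < n -> k < n -> site l j = site l k -> j = k.
Proof. by move=> jn kn /(congr1 (cw_dist l)); rewrite !cw_dist_site. Qed.

Definition conf l w : config n := [set i | nth false w (cw_dist l i)].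

Lemma in_conf l w k : k < n -> (site l k \in conf l w) = nth false w k.
Proof. by move=> kn; rewrite inE cw_dist_site. Qed.

Lemma conf_ext l w A : (forall k, k < n -> (site l k \in A) = nth false w k) ->
  A = conf l w.
Proof.
move=> H; apply/setP => i; rewrite -(site_cw_dist l i).
by rewrite H ?in_conf ?cw_dist_lt.
Qed.

Lemma conf_mkseq l A : A = conf l (mkseq (fun k => site l k \in A) n).
Proof. by apply: conf_ext => k kn; rewrite nth_mkseq. Qed.

(** Re-reads the circle from one site further left, as needed when the cluster gains a particle at
    its left end. *)
Lemma conf_rcons l w b : size w = n.-1 ->
  conf l (rcons w b) = conf (ord_pred l) (b :: w).
Proof.
move=> sw; have n0 : 0 < n by exact: leq_ltn_trans (ltn_ord l).
apply: conf_ext => k kn.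
case: k kn => [|k] kn /=.
  by rewrite ord_pred_site0 in_conf ?nth_rcons ?sw ?ltnn ?eqxx ?prednK.
rewrite /site -iterS iterSr ord_predK -/(site l k) in_conf; last by lia.
by rewrite nth_rcons sw; case: ltngtP => //; lia.
Qed.

Lemma card_conf l w : size w = n -> #|conf l w| = count id w.
Proof.
move=> sw.
rewrite cardsE -sum1_card (reindex (fun k : 'I_n => site l k)) /=; last first.
  exists (fun i => Ordinal (cw_dist_lt l i)) => i _.
    by apply: val_inj; rewrite /= cw_dist_site.
  exact: site_cw_dist.
rewrite -sum1_count (big_nth false) sw big_mkord.
by apply: eq_bigl => k; rewrite /= unfold_in cw_dist_site.
Qed.

End Conf.

(** * Cluster states and their moves *)

Lemma nth_nseq_cat c b (s : bitseq) k :
  nth false (nseq c b ++ s) k = if k < c then b else nth false s (k - c).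
Proof. by rewrite nth_cat size_nseq nth_nseq; case: ltnP. Qed.

Lemma boxes_head (bs : bitseq) : nth false (boxes bs ++ [:: false]) 0 = false.
Proof. by case: bs => // -[]. Qed.

Lemma boxes_last (bs : bitseq) k : size (boxes bs) <= k ->
  nth false (boxes bs ++ [:: false]) k = false.
Proof. by move=> H; rewrite nth_cat ltnNge H /=; case: (k - _) => // -[]. Qed.

Lemma boxes_nadj (bs : bitseq) k :
  nadj (nth false (boxes bs ++ [:: false]) k) (nth false (boxes bs ++ [:: false]) k.+1).
Proof.
have [H|H] := ltnP k.+1 (size (boxes bs ++ [:: false])).
  exact: (sortedP _ (boxes_sorted bs)).
by rewrite /nadj [nth _ _ k.+1]nth_default // andbF.
Qed.

(* Read clockwise from the leftmost particle of the cluster: the cluster, then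
   the holes, each followed by its at most one particle.  A word whose cluster
   has one particle encodes an ideal state with a distinguished particle. *)
Definition cword m bs := nseq (m - count id bs) true ++ boxes bs ++ [:: false].

Lemma size_cword m bs : count id bs <= m -> size (cword m bs) = (m + size bs).+1.
Proof. by move=> H; rewrite !size_cat size_nseq size_boxes /=; lia. Qed.

Lemma count_cword m bs : count id bs <= m -> count id (cword m bs) = m.
Proof. by move=> H; rewrite !count_cat count_nseq count_boxes /=; lia. Qed.

Section SumProd.
Local Open Scope ring_scope.
(** Only [i0] moves at random, so the product weight of any set other than [M0] and [i0 |: M0]
    contains a zero factor. *)
Lemma sum_movers (R : realType) (n : nat) (p : R) (eta M0 : config n) i0
    (F : config n -> R) :
  i0 \notin M0 -> jump_prob p eta i0 = p ->
  (forall i, i != i0 -> jump_prob p eta i = (i \in M0)%:R) ->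
  \sum_M movers_prob p eta M * F M = p * F (i0 |: M0) + (1 - p) * F M0.
Proof.
move=> i0M p0 pi.
have neq : i0 |: M0 != M0 by apply: contra i0M => /eqP <-; rewrite !inE eqxx.
have prodE (M : config n) : (forall i, i != i0 -> (i \in M) = (i \in M0)) ->
    movers_prob p eta M = if i0 \in M then p else 1 - p.
  move=> H; rewrite /movers_prob (bigD1 i0) //= p0 big1 ?mulr1 // => i ii0.
  by rewrite (H i ii0) pi //; case: (i \in M0); rewrite ?subr0.
rewrite (bigD1 (i0 |: M0)) //= (bigD1 M0) 1?eq_sym //= addrA big1 ?addr0.
  have -> : movers_prob p eta (i0 |: M0) = p.
    rewrite prodE ?setU11 // => i ii0; by rewrite !inE (negPf ii0).
  by rewrite prodE // (negPf i0M).
move=> M /andP[H1 H2].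
have [i /andP[ii0 Hi]] : exists i, (i != i0) && ((i \in M) != (i \in M0)).
  apply/existsP; apply: contraT; rewrite negb_exists => /forallP H.
  have H3 i : i != i0 -> (i \in M) = (i \in M0).
    by move=> ii0; have := H i; rewrite ii0 negbK => /eqP.
  have [i0M'|i0M'] := boolP (i0 \in M).
    case/negP: H1; apply/eqP/setP => i; rewrite !inE.
    by have [->|/H3 ->] := eqVneq i i0; rewrite ?i0M'.
  case/negP: H2; apply/eqP/setP => i.
  by have [->|/H3 ->] := eqVneq i i0; rewrite ?(negPf i0M) ?(negPf i0M').
rewrite /movers_prob (bigD1 i) //= pi //.
by case: (i \in M) Hi; case: (i \in M0) => // _; rewrite ?subrr !mul0r.
Qed.

Lemma sum_movers_det (R : realType) (n : nat) (p : R) (eta M0 : config n)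
    (F : config n -> R) :
  (forall i, jump_prob p eta i = (i \in M0)%:R) ->
  \sum_M movers_prob p eta M * F M = F M0.
Proof.
move=> pi.
rewrite (bigD1 M0) //= big1 ?addr0 => [|M neq].
  rewrite /movers_prob big1 ?mul1r // => i _; rewrite pi.
  by case: (i \in M0); rewrite ?subr0.
have [i Hi] : exists i, (i \in M) != (i \in M0).
  apply/existsP; apply: contraT; rewrite negb_exists => /forallP H.
  by case/negP: neq; apply/eqP/setP => i; have := H i; rewrite negbK => /eqP.
rewrite /movers_prob (bigD1 i) //= pi.
by case: (i \in M) Hi; case: (i \in M0) => // _; rewrite ?subrr !mul0r.
Qed.
End SumProd.

Lemma in_moved n (eta M : config n) i :
  (i \in moved eta M) = (i \in eta) && (i \notin M) || (ord_pred i \in M).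
Proof.
rewrite !inE andbC; congr (_ || _); apply/imsetP/idP => [[j jM ->]|H].
  by rewrite ordSK.
by exists (ord_pred i); rewrite // ord_predK.
Qed.

Section State.
Variables (n m L : nat).
Hypothesis Hn : n = (m + L).+1.
Implicit Types (l i : 'I_n) (bs : bitseq).

Definition st l bs : config n := conf l (cword m bs).

Variables (l : 'I_n) (bs : bitseq).
Hypothesis sbs : size bs = L.
Hypothesis cbs : count id bs < m.

Let c := m - count id bs.

Let c_gt0 : 0 < c. Proof. by rewrite subn_gt0. Qed.

Lemma size_cword_n : size (cword m bs) = n.
Proof. by rewrite size_cword ?sbs // ltnW. Qed.

Let v := boxes bs ++ [:: false].
Let sv : c + size v = n.
Proof. by rewrite -[RHS]size_cword_n [in RHS]size_cat size_nseq. Qed.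
Let szv : size v = (size (boxes bs)).+1.
Proof. by rewrite size_cat addn1. Qed.

Lemma in_st k : k < n -> (site l k \in st l bs) = (if k < c then true else nth false v (k - c)).
Proof. by move=> kn; rewrite in_conf // nth_nseq_cat. Qed.

Lemma card_st : #|st l bs| = m.
Proof. by rewrite card_conf ?size_cword_n // count_cword // ltnW. Qed.

Let vlast k : c + k = n.-1 -> nth false v k = false.
Proof. by move=> H; apply: boxes_last; move: sv; rewrite szv; lia. Qed.

(** Adjacent particles occur only inside the leading block: the boxes contain none, and the trailing
    hole separates them from the block across the end of the word. *)
Lemma is_cluster_st (C : 'I_n * 'I_n) :
  is_cluster (st l bs) C = [&& 1 < c, C.1 == l & C.2 == c :> nat].
Proof.
case: C => l' k /=; apply/and4P/and3P => /=; last first.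
  case=> c2 /eqP -> /eqP ->; have cn : c < n by lia.
  split=> //.
  - apply/forallP => j; apply/implyP => jc.
    by rewrite -/(site l j) in_st ?jc // (ltn_trans jc).
  - have n1 : n.-1 < n by lia.
    rewrite ord_pred_site0 in_st // ifF; last by lia.
    by rewrite vlast // subnKC //; lia.
  - by rewrite -/(site l c) in_st // ltnn subnn boxes_head.
case=> k2 /forallP /= occ hl hr.
have n1 : 1 < n by apply: ltn_trans k2 (ltn_ord k).
move: occ hl hr; rewrite -(site_cw_dist l l').
set i := cw_dist l l' => occ hl hr.
have i_n : i < n by exact: cw_dist_lt.
have o0 := occ (Ordinal (ltnW n1)); have o1 := occ (Ordinal n1).
move: o0 o1; rewrite /= k2 (ltnW k2) /= => o0 o1.
have Si : i.+1 < n.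
  move: o0; rewrite in_st //; case: ltnP => [|ci H]; first by lia.
  have [//|H2] := ltnP i.+1 n.
  by move: H; rewrite vlast //; lia.
have iSc : i.+1 < c.
  move: o0 o1; rewrite ordS_site !in_st //.
  have [ic _|ci o0] := ltnP i c; last first.
    by rewrite [i.+1 < c]ltnNge ltnW //= => o1; have := boxes_nadj bs (i - c);
      rewrite /nadj -subSn // o0 o1.
  case: (ltngtP i.+1 c) => // [|->]; first by lia.
  by rewrite subnn boxes_head.
have i0 : i = 0.
  move: hl; case: (i) Si iSc => // j Sj jc.
  by rewrite ord_pred_siteS in_st ?ifT //; lia.
move: occ hr; rewrite i0 => occ hr.
split=> //; first by lia.
have cn : c < n by lia.
have [kc|kc|//] := ltngtP k c.
  by move: hr; rewrite -/(site _ _) in_st ?kc.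
have := occ (Ordinal cn); rewrite /= kc /= -/(site _ _) in_st //.
by rewrite ltnn subnn boxes_head.
Qed.

Lemma ideal_st : ideal (st l bs) = (c <= 1).
Proof.
rewrite /ideal leqNgt; congr (~~ _); apply/existsP/idP => [[C]|c1].
  by rewrite is_cluster_st => /and3P[].
have cn : c < n by move: sv; rewrite szv; lia.
by exists (l, Ordinal cn); rewrite is_cluster_st c1 /= !eqxx.
Qed.

Lemma cluster_st : 1 < c -> forall s,
  left_site (st l bs) s = l /\ cluster_span (st l bs) = c.-1.
Proof.
move=> c1 s; rewrite /left_site /cluster_span.
case: pickP => [C|H].
  by rewrite is_cluster_st => /and3P[_ /eqP -> /eqP ->].
have cn : c < n by move: sv; rewrite szv; lia.
by have := H (l, Ordinal cn); rewrite is_cluster_st c1 /= !eqxx.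
Qed.

(** The bit [b] decides on the rightmost particle of the cluster. All particles of [v] are free, so
    [v] itself marks those that move. *)
Definition movers b : config n := conf l (nseq c.-1 false ++ b :: v).

Lemma in_movers b k : k < n ->
  (site l k \in movers b) = (if k < c.-1 then false else nth false (b :: v) (k - c.-1)).
Proof. by move=> kn; rewrite in_conf // nth_nseq_cat. Qed.

Lemma card_movers b : #|movers b| = count id bs + b.
Proof.
rewrite card_conf; last by rewrite size_cat size_nseq /= addnS -addSn prednK.
by rewrite count_cat count_nseq /= count_cat count_boxes /=; lia.
Qed.

Lemma sum_movers_st (R : realType) (p : R) (F : config n -> R) : 1 < c ->
  (\sum_M movers_prob p (st l bs) M * F M =
    p * F (movers true) + (1 - p) * F (movers false))%R.
Proof.
move=> c2.
have cn : c.-1 < n by lia.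
have c1n : c.-1.+1 < n by move: sv; rewrite szv; lia.
have -> : movers true = site l c.-1 |: movers false.
  apply/setP => i; rewrite -(site_cw_dist l i) in_setU1.
  set k := cw_dist l i; have kn : k < n by exact: cw_dist_lt.
  have -> : (site l k == site l c.-1) = (k == c.-1).
    by apply/eqP/eqP => [/site_inj -> | ->].
  rewrite !in_movers //; case: ltngtP => //= [H|->]; last by rewrite subnn.
  by case E : (k - c.-1) => //; lia.
apply: sum_movers.
- by rewrite in_movers // ltnn subnn.
- have in0 : site l c.-1 \in st l bs by rewrite in_st // ifT //; lia.
  have inS : ordS (site l c.-1) \in st l bs = false.
    rewrite ordS_site in_st // ifF; last by lia.
    by rewrite (_ : c.-1.+1 - c = 0) ?boxes_head //; lia.
  have inP : ord_pred (site l c.-1) \in st l bs.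
    rewrite (_ : c.-1 = c.-2.+1); last by lia.
    by rewrite ord_pred_siteS in_st ?ifT //; lia.
  by rewrite /jump_prob in0 inS inP.
move=> i; rewrite -(site_cw_dist l i).
set k := cw_dist l i; have kn : k < n by exact: cw_dist_lt.
move=> kc; have {}kc : k != c.-1 by apply: contraNneq kc => ->.
rewrite in_movers //; case: (ltngtP k c.-1) kc => // kc _.
  have inS : ordS (site l k) \in st l bs.
    by rewrite ordS_site in_st ?ifT //; lia.
  by rewrite /jump_prob inS andbF.
rewrite /jump_prob in_st // ltnNge (_ : c <= k) /=; last by lia.
case E : (k - c.-1) => [|j]; first by lia.
have -> : k - c = j by lia.
rewrite [nth _ (_ :: _) _]/=.
have [vj|] /= := boolP (nth false v j); last by [].
have Sk : k.+1 < n.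
  have [//|H2] := ltnP k.+1 n.
  by move: vj; rewrite vlast //; lia.
rewrite ordS_site in_st // ltnNge (_ : c <= k.+1) /=; last by lia.
have -> : k.+1 - c = j.+1 by lia.
have := boxes_nadj bs j; rewrite /nadj -/v vj /= => ->.
case: j E vj => [|j] E vj; first by rewrite boxes_head in vj.
case: k kn kc Sk E => // k kn kc Sk E.
rewrite ord_pred_siteS in_st; last by lia.
rewrite ltnNge (_ : c <= k) /=; last by lia.
have -> : k - c = j by lia.
by have := boxes_nadj bs j; rewrite /nadj -/v vj andbT => /negPf ->.
Qed.

(** The free particles all shift by one site, so [boxes bs] reappears one site further right and
    overwrites the trailing hole, while the new box [b] opens at the right end of the cluster. *)
Lemma moved_st b : 1 < c ->
  moved (st l bs) (movers b) = conf l (nseq (c - b) true ++ boxes (b :: bs)).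
Proof.
move=> c2; apply: conf_ext => k kn; rewrite in_moved nth_nseq_cat.
case: k kn => [|k] kn.
  have -> : site l 0 \in st l bs by rewrite in_st // c_gt0.
  have -> : site l 0 \in movers b = false by rewrite in_movers // ifT //; lia.
  by rewrite (_ : 0 < c - b) //; case: (b); lia.
rewrite ord_pred_siteS in_st // (in_movers b kn) (in_movers b (ltnW kn)).
have [kc1|kc1] := ltnP k c.-1.
  rewrite ifT; last by lia.
  have [kc2|kc2] := ltnP k.+1 c.-1.
    by rewrite ifT //; case: (b); lia.
  rewrite (_ : k.+1 - c.-1 = 0) /=; last by lia.
  rewrite orbF; case: (b) => /=; last by rewrite ifT //; lia.
  by rewrite ifF /=; [rewrite (_ : _ - _ = 0) //|]; lia.
have [kc2|kc2] := ltnP k.+1 c; first by lia.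
rewrite ifF; last by lia.
rewrite ifF; last by case: (b); lia.
have -> : nth false (b :: v) (k.+1 - c.-1) = nth false v (k.+1 - c).
  by rewrite (_ : k.+1 - c.-1 = (k.+1 - c).+1) //; lia.
rewrite andbN /=.
case E : (k - c.-1) => [|j] /=.
  by case: (b); [rewrite (_ : k.+1 - (c - _) = 1)|rewrite (_ : k.+1 - (c - _) = 0)] => //; lia.
have jb : j < size (boxes bs) by move: sv; rewrite szv; lia.
rewrite /v nth_cat jb.
by case: (b); [rewrite (_ : k.+1 - (c - _) = j.+2)|rewrite (_ : k.+1 - (c - _) = j.+1)] =>
  //; lia.
Qed.

End State.

(* In the box encoding the cluster sweeps one box per step: it swallows the
   content [x] of the last box and leaves behind a new first box [b]. *)
Lemma moved_st_rcons n m L (l : 'I_n) bs x b : n = (m + L).+1 ->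
  (size bs).+1 = L -> 1 < m - count id (rcons bs x) ->
  moved (st m l (rcons bs x)) (movers m l (rcons bs x) b) =
    st m (if x then ord_pred l else l) (b :: bs).
Proof.
move=> Hn sbs c2; rewrite (@moved_st _ _ L) ?size_rcons //; last by lia.
rewrite /st /cword -cats1 -cat_cons boxes_cat.
move: c2; rewrite -cats1 count_cat /= addn0 => c2.
case: x c2 => /= c2.
  rewrite (_ : _ ++ _ = rcons (nseq (m - (count id bs + 1) - b) true ++ boxes (b :: bs) ++
    [:: false]) true); last first.
    by rewrite -cats1 -!catA.
  rewrite conf_rcons -?cat_cons; last first.
    rewrite !size_cat size_nseq size_boxes /=; case: b => /=; lia.
  congr (conf _ (_ ++ _)).
  rewrite -[LHS]/(nseq _.+1 true); congr nseq; case: b => /=; lia.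
by congr (conf _ (nseq _ _ ++ _)); lia.
Qed.

(** * Reachable states and perturbations *)

(** Invariant satisfied by all reachable states, the ideal ones included. *)
Definition good n m L (eta : config n) : Prop :=
  exists l bs, [/\ size bs = L, count id bs < m & eta = st m l bs].

Definition isolated n (eta : config n) : Prop :=
  forall i, i \in eta -> ordS i \notin eta.

Section Good.
Variables (n m L : nat).
Hypothesis Hn : n = (m + L).+1.
Implicit Types (eta e : config n) (l a b i : 'I_n).

Lemma good_conf eta l c v : #|eta| = m -> eta = conf l (nseq c true ++ v) ->
  0 < c -> c + size v = n -> v != [::] -> head false v = false ->
  last false v = false -> sorted nadj v ->
  exists bs, [/\ size bs = L, count id bs + c = m & eta = st m l bs].
Proof.
move=> ce E c0 sv v0 hv lv pv.
have [bs Ev] := boxes_parse v0 hv lv pv.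
have cm : c + count id bs = m.
  rewrite -ce E card_conf ?size_cat ?size_nseq // count_cat count_nseq mul1n Ev.
  by rewrite count_cat count_boxes /= !addn0.
exists bs; split.
- by move: sv; rewrite Ev size_cat size_boxes /=; lia.
- by lia.
- by rewrite E /st /cword Ev; congr (conf _ (nseq _ _ ++ _)); lia.
Qed.

(** If [v] begins with a particle, that particle joins the block, and the letter after it must be a
    hole. *)
Lemma good_conf_last eta l c v : #|eta| = m -> eta = conf l (nseq c true ++ v) ->
  0 < c -> c + size v = n -> v != [::] ->
  last false v = false -> sorted nadj v -> good m L eta.
Proof.
move=> ce E c0 sv v0 lv pv.
suff [c' [bs [c'0 [H1 H2 H3]]]] : exists c' bs, 0 < c' /\
    [/\ size bs = L, count id bs + c' = m & eta = st m l bs].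
  by exists l, bs; split=> //; lia.
case: v v0 lv pv sv E => // -[] v _ lv pv sv E; last first.
  by exists c; have [bs H] := good_conf ce E c0 sv isT erefl lv pv; exists bs.
exists c.+1.
have [|||||||bs H] := @good_conf eta l c.+1 v ce; last by exists bs.
- by rewrite E -cat_rcons; congr (conf _ (_ ++ _)); elim: (c) => //= ? ->.
- by [].
- by move: sv => /=; lia.
- by case: v lv pv sv E.
- by case: v lv pv sv E => // -[].
- by case: v lv pv sv E.
- by case: v lv pv sv E => // ? ? /= ? /andP[].
Qed.

Lemma isolated_word eta l w : size w = n -> eta = conf l w -> isolated eta ->
  sorted nadj w /\ nadj (last false w) (head false w).
Proof.
move=> sw E iso; have n0 : 0 < n by rewrite Hn.
split.
  apply/(sortedP false) => k; rewrite sw => kn.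
  have kn' : k < n by exact: ltnW.
  have := iso (site l k); rewrite ordS_site E !in_conf // /nadj.
  by case: (nth _ _ k) => //= ->.
have n1 : n.-1 < n by lia.
have := iso (site l n.-1); rewrite ordS_site prednK // site_n E in_conf //.
rewrite -[l in l \notin _]/(site l 0) in_conf // nth0 -[n.-1]/(n.-1) -sw nth_last /nadj.
by case: (last _ _) => //= ->.
Qed.

(** In an ideal state any particle may be the distinguished one; the cycle lemma exploits this
    freedom. *)
Lemma isolated_good eta l : isolated eta -> #|eta| = m -> l \in eta ->
  exists bs, [/\ size bs = L, count id bs + 1 = m & eta = st m l bs].
Proof.
move=> iso ce le.
have E := conf_mkseq l eta; set w := mkseq _ _ in E.
have sw : size w = n by rewrite size_mkseq.
have [pw cw] := isolated_word sw E iso.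
have hw : head false w = true.
  by rewrite -nth0 nth_mkseq // Hn.
have m0 : 0 < m by rewrite -ce card_gt0; apply/set0Pn; exists l.
case: (w) sw pw cw hw E => // x v sw pw cw /= hx E; subst x.
apply: (@good_conf eta l 1 v) => //.
- by case: (v) sw => //=; lia.
- by case: (v) pw => // -[].
- by move: cw; rewrite /nadj /= andbT => /negPf; case: (v).
- by case: (v) pw => // ? ? /andP[].
Qed.

Lemma st_isolated l bs : size bs = L -> count id bs + 1 = m ->
  isolated (st m l bs).
Proof.
move=> sbs cbs i.
have c1 : m - count id bs = 1 by lia.
have sw : size (cword m bs) = n by rewrite (size_cword_n Hn sbs) //; lia.
rewrite -(site_cw_dist l i); set k := cw_dist l i.
have kn : k < n by exact: cw_dist_lt.
rewrite ordS_site in_conf // => wk.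
have [Sk|Sk] := ltnP k.+1 n.
  rewrite in_conf //; move: wk; rewrite /cword c1 /=.
  case: k {kn Sk} => [|k] /= wk; first by rewrite boxes_head.
  by have := boxes_nadj bs k; rewrite /nadj wk.
have k1 : k = (size (cword m bs)).-1 by rewrite sw; lia.
move: wk; rewrite k1 /cword c1 /= size_cat addn1 /= boxes_last //.
Qed.

Lemma jump_isolated (R : realType) (p : R) eta i : isolated eta ->
  jump_prob p eta i = ((i \in eta)%:R)%R.
Proof.
move=> iso; rewrite /jump_prob; case: (boolP (i \in eta)) => //= ie.
rewrite iso //= ifN //; apply: contraL ie => H.
by have := iso _ H; rewrite ord_predK.
Qed.

Lemma moved_isolated l bs : size bs = L -> count id bs + 1 = m ->
  moved (st m l bs) (st m l bs) = st m (ordS l) bs.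
Proof.
move=> sbs cbs; apply: conf_ext => k kn.
have -> : site (ordS l) k = ordS (site l k) by rewrite /site -iterSr.
by rewrite in_moved andbN /= ordSK in_conf.
Qed.

Lemma good_one_cluster eta : one_cluster m eta -> good m L eta.
Proof.
case/andP => /eqP ce /existsP[[l k] /andP[/and4P[/= k2 /forallP occ _ _] /eqP km]].
exists l, (nseq L false); split; rewrite ?size_nseq ?count_nseq //.
  by rewrite mul0n -km; lia.
apply/esym/eqP; rewrite eqEcard ce (card_st Hn) ?size_nseq ?count_nseq //;
  last by rewrite mul0n -km; lia.
rewrite leqnn andbT; apply/fintype.subsetP => i.
rewrite -(site_cw_dist l i); set j := cw_dist l i.
have jn : j < n by exact: cw_dist_lt.
rewrite in_conf // nth_nseq_cat count_nseq mul0n subn0 boxes_nseq.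
case: ltnP => jm; last by rewrite nth_nseq_cat; case: ifP => // _; case: (_ - _) => // -[].
by move=> _; have := occ (Ordinal jn); rewrite /= km jm.
Qed.

Lemma card_relocated e a b : a \in e -> b \notin e :\ a ->
  #|relocated e a b| = #|e|.
Proof. by move=> ae be; rewrite cardsU1 be [RHS](cardsD1 a) ae. Qed.

(** Apart from [b], the new state inherits isolation from [e], so a cluster can only consist of [b]
    and its neighbours. The word is read from [b] or, if the left neighbour is occupied, from that
    neighbour. *)
Lemma good_relocated e a b : 0 < m -> isolated e -> #|e| = m -> a \in e ->
  b \notin e :\ a -> good m L (relocated e a b).
Proof.
move=> m0 iso ce ae be; set A := relocated e a b.
have cA : #|A| = m by rewrite card_relocated.
have bA : b \in A by rewrite !inE eqxx.
have E := conf_mkseq b A.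
set u := mkseq (fun k => site b k.+1 \in A) n.-1.
have n1 : n = n.-1.+1 by lia.
have {}E : A = conf b (true :: u).
  apply: conf_ext => -[|k] kn //=; rewrite nth_mkseq //; lia.
have su : size u = n.-1 by rewrite size_mkseq.
have inA k : k.+1 < n -> site b k.+1 \in A -> site b k.+1 \in e.
  move=> kn; rewrite !inE => /orP[/eqP H|/andP[]//].
  have n0 : 0 < n by lia.
  by have := @site_inj _ b k.+1 0 kn n0 H.
have pu : sorted nadj u.
  apply/(sortedP false) => k; rewrite su => kn.
  rewrite !nth_mkseq //; last by lia.
  apply/negP => /andP[H1 H2].
  have /iso : site b k.+1 \in e by apply: inA => //; lia.
  by rewrite ordS_site inA //; lia.
have [lu|lu] := boolP (last false u); last first.
  apply: (@good_conf_last A b 1 u) => //.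
  - by rewrite su add1n -n1.
  - by case: (u) su => //=; lia.
  - exact: negPf.
case/lastP: u su pu E lu => // u0 [] su pu E; rewrite last_rcons // => _.
move: E; rewrite -rcons_cons conf_rcons; last first.
  by move: su; rewrite size_rcons /= => ->.
move=> E.
have u0n : u0 != [::].
  case: (u0) su E => //= su E.
  have n2 : n = 2 by lia.
  have : #|A| = 2 by rewrite E card_conf.
  by rewrite cA; lia.
apply: (@good_conf_last A (ord_pred b) 2 u0) => //.
- by move: su; rewrite size_rcons; lia.
- case/lastP: (u0) u0n pu => // u1 y _; rewrite last_rcons.
  case: u1 => [|z u1] /=; rewrite ?rcons_path ?last_rcons /nadj.
    by rewrite !andbT => /negPf.
  by rewrite andbT => /andP[_ /negPf].
- by move: pu; rewrite -cats1 => /cat_sorted2[].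
Qed.

End Good.

Local Open Scope classical_set_scope.
Local Open Scope ring_scope.

(** * Favourable perturbations of an ideal state *)

Section Cycle.
Variables (R : realType) (n m L : nat) (e : config n).
Hypothesis Hn : n = (m + L).+1.
Hypothesis ce : #|e| = m.

(** [a] is the number of particles per hole. With steps [1] and [- a] the height [P] returns to 0
    after one turn, hence is well defined on the circle. *)
Let a : R := m%:R / L.+1%:R.
Let d (i : 'I_n) : R := if i \in e then 1 else - a.
Let P (k : nat) : R := \sum_(i : 'I_n | (i < k)%N) d i.

Let sum_d : \sum_i d i = 0.
Proof.
rewrite (bigID (mem e)) /= (eq_bigr (fun=> 1)) => [|i ie]; last by rewrite /d ie.
rewrite [X in _ + X](eq_bigr (fun=> - a)) => [|i ie]; last by rewrite /d (negPf ie).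
rewrite !sumr_const ce.
have -> : #|[pred i | i \notin e]| = L.+1.
  have H := cardC (mem e); rewrite ce card_ord in H.
  by apply: (@addnI m); apply: (etrans H); rewrite addnS.
by rewrite mulNrn -[a *+ _]mulr_natr /a divfK ?subrr // pnatr_eq0.
Qed.

Let P_ordS (i : 'I_n) : P (ordS i) = P i + d i.
Proof.
have [Si|Si] := ltnP i.+1 n.
  rewrite /P /= modn_small // (bigD1 i) //= addrC; congr (_ + _).
  by apply: eq_bigl => j; rewrite ltnS ltn_neqAle andbC -val_eqE.
have iE : i.+1 = n by have := ltn_ord i; lia.
have -> : P (ordS i) = 0 by rewrite /P /= iE modnn big_pred0.
rewrite -[LHS]sum_d (bigD1 i) //= addrC /P; congr (_ + _).
apply: eq_bigl => j; rewrite ltn_neqAle -val_eqE /= andbC.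
by have -> : (j <= i)%N by have := ltn_ord j; lia.
Qed.

Let suffix l k : (k <= n)%N ->
  \sum_(k <= j < n) d (site l j) = P (site l n) - P (site l k).
Proof.
move=> kn.
rewrite -(telescope_sumr (fun j => P (site l j))) //.
by apply: eq_bigr => j _; rewrite [site l j.+1]/= P_ordS addrAC subrr add0r.
Qed.

Let sum_boxes (bs : bitseq) :
  \sum_(x <- boxes bs) (if x then 1 else - a) = (count id bs)%:R - a * (size bs)%:R.
Proof.
elim: bs => [|b bs IH]; first by rewrite big_nil mulr0 subrr.
rewrite boxes_cons big_cat /= IH; case: b;
  rewrite ?(big_cons, big_nil) /= natrD -[in RHS]natr1; ring.
Qed.

(* Cycle lemma: start at a particle maximizing the height [P]. *)
Lemma cycle_start : (0 < m)%N -> exists2 l, l \in e &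
  forall bs, size bs = L -> e = st m l bs -> (count id bs + 1 = m)%N ->
  forall b1 b2, bs = b1 ++ b2 ->
    (m%:R / L.+1%:R) * (size b2)%:R - 1 <= (count id b2)%:R :> R.
Proof.
move=> m0.
have /set0Pn [l0 l0e] : e != finset.set0 by rewrite -card_gt0 ce.
case: (@arg_maxP _ _ _ l0 (mem e) (fun i : 'I_n => P i) l0e) => l le lmax.
exists l => // bs sbs E cbs b1 b2 bsE; rewrite -/a.
have aN : a * L.+1%:R = m%:R by rewrite /a divfK.
have a0 : 0 <= a by rewrite divr_ge0.
have cw : size (cword m bs) = n by rewrite (size_cword_n Hn sbs) //; lia.
have cbsR : (count id bs)%:R + 1 = m%:R :> R by rewrite natr1 -cbs addn1.
have sbsR : L.+1%:R = (size bs)%:R + 1 :> R by rewrite sbs natr1.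
(* Suffixes matter because the cluster swallows the boxes from the last one on. If [b1] ends with an
   occupied box, its particle competes with [l] for the maximal height. An empty last box is moved
   into [b2], which only strengthens the bound. *)
elim/last_ind: b1 b2 bsE => [|b1 [] IH] b2 bsE.
- rewrite /= in bsE; rewrite -bsE; nra.
- set k := (size (boxes b1)).+2.
  pose W2 := true :: boxes b2 ++ [:: false].
  have WE : cword m bs = (true :: boxes b1 ++ [:: false]) ++ W2.
    rewrite /cword (_ : m - _ = 1)%N; last by lia.
    by rewrite bsE -cats1 !boxes_cat /W2 /= -!catA.
  have dW : drop k (cword m bs) = W2.
    by rewrite WE drop_size_cat //= size_cat addn1.
  have kn : (k < n)%N by rewrite -cw WE size_cat /= size_cat /= /k; lia.
  have ke : site l k \in e.
    by rewrite E in_conf // -[k]addn0 -nth_drop dW.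
  have : 0 <= P (site l n) - P (site l k) by rewrite site_n subr_ge0; exact: lmax.
  rewrite -suffix; last exact: ltnW.
  rewrite (eq_big_nat _ _ (F2 := fun j => if nth false (cword m bs) j then 1 else - a));
    last first.
    by move=> j /andP[_ jn]; rewrite /d {1}E in_conf.
  rewrite -{1}[k]add0n big_addn.
  rewrite (eq_bigr (fun j => if nth false W2 j then 1 else - a)); last first.
    by move=> j _; rewrite -dW nth_drop addnC.
  have -> : (n - k = size W2)%N by rewrite -dW size_drop cw.
  rewrite -(big_nth false xpredT (fun x => if x then 1 else - a)) big_cons big_cat /=.
  rewrite sum_boxes big_seq1; nra.
- have := IH (false :: b2); rewrite -cat_rcons => /(_ bsE) /=.
  by rewrite add0n -natr1; nra.
Qed.
End Cycle.

Lemma first_true (bs : bitseq) : (0 < count id bs)%N ->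
  exists k bs2, bs = nseq k false ++ true :: bs2.
Proof.
elim: bs => // -[] bs IH; first by exists 0%N, bs.
by move=> /IH[k [bs2 ->]]; exists k.+1, bs2.
Qed.

Lemma cat_split (T : Type) (s1 s2 t1 t2 : seq T) : s1 ++ s2 = t1 ++ t2 ->
  (size t2 <= size s2)%N -> exists s, s2 = s ++ t2.
Proof.
move=> E sz; exists (take (size s2 - size t2) s2).
have E2 : (size s1 + size s2 = size t1 + size t2)%N by rewrite -!size_cat E.
suff E3 : t2 = drop (size s2 - size t2) s2 by rewrite [X in _ = _ ++ X]E3 cat_take_drop.
rewrite -[LHS](drop_size_cat t2 (erefl (size t1))) -E drop_cat ifF; last by lia.
by congr drop; lia.
Qed.

Lemma nth_relocated k j (X : bitseq) :
  (j == 1)%N || (j != k.+2) && nth false (true :: nseq k.+1 false ++ true :: X) j =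
  nth false [:: true, true & nseq k.+1 false ++ X] j.
Proof.
case: j => [|[|j]] //.
rewrite -[nth _ (true :: _) _]/(nth false (nseq k.+1 false ++ true :: X) j.+1).
rewrite -[nth _ [:: _, _ & _] _]/(nth false (nseq k.+1 false ++ X) j).
rewrite !nth_nseq_cat !eqSS ltnS /=; case: (ltngtP j k) => [jk|jk|->].
- by rewrite ltnW.
- by rewrite ifF ?subSS; [rewrite subnS; case: (j - k)%N (subn_gt0 k j) => [|?];
  rewrite jk|lia].
- by rewrite ltnSn.
Qed.

(* The next particle to the right of [l] is moved next to [l]: the resulting pair
   reaches the box emptied by this move last, so until it has swallowed all the
   other particles it meets the same boxes as before the move. *)
Lemma good_start (R : realType) n m L (e : config n) : n = (m + L).+1 ->
  isolated e -> #|e| = m -> (1 < m)%N ->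
  exists a b l bs, [/\ a \in e, b \notin e :\ a, relocated e a b = st m l bs,
    size bs = L /\ (count id bs + 2 = m)%N &
    forall b1 b2, bs = b1 ++ b2 ->
      m%:R / L.+1%:R * (size b2)%:R - 1 <= (count id b2)%:R :> R \/
      (count id b2 + 2 = m)%N].
Proof.
move=> Hn iso ce m1.
have [l le lP] := cycle_start R Hn ce (ltnW m1).
have [bs [sbs cbs E]] := isolated_good Hn iso ce le.
have {}lP := lP _ sbs E cbs.
have /first_true [k [bs2 bsE]] : (0 < count id bs)%N by lia.
have cbs2 : (count id bs2 + 2 = m)%N.
  by move: cbs; rewrite bsE count_cat count_nseq /=; lia.
pose bs' := nseq k.+1 false ++ bs2.
have cbs' : (count id bs' + 2 = m)%N by rewrite count_cat count_nseq /=; lia.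
have WE : cword m bs = true :: nseq k.+1 false ++ true :: boxes bs2 ++ [:: false].
  rewrite /cword (_ : m - _ = 1)%N; last by lia.
  rewrite bsE boxes_cat boxes_nseq boxes_cons /= -!catA /=.
  by congr (true :: _); elim: (k) => //= ? ->.
have WE' : cword m bs' = true :: true :: nseq k.+1 false ++ boxes bs2 ++ [:: false].
  rewrite /cword (_ : m - _ = 2)%N; last by lia.
  by rewrite boxes_cat boxes_nseq -catA.
have cw : size (cword m bs) = n by rewrite (size_cword_n Hn sbs) //; lia.
have kn : (k.+2 < n)%N by rewrite -cw WE /= size_cat size_nseq /=; lia.
have n1 : (1 < n)%N by lia.
exists (site l k.+2), (site l 1), l, bs'; split.
- by rewrite E in_conf // WE /= -cat_rcons nth_cat size_rcons size_nseq ltnSn nth_rcons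
  size_nseq ltnn eqxx.
- rewrite !inE negb_and; apply/orP; right.
  by rewrite E in_conf // WE.
- apply: conf_ext => j jn; rewrite !inE.
  have n0 : (0 < n)%N by lia.
  have sE i i' : (i < n)%N -> (i' < n)%N -> (site l i == site l i') = (i == i').
    by move=> ii ii'; apply/eqP/eqP => [/site_inj -> | ->].
  by rewrite !sE // E in_conf // WE WE' nth_relocated.
- by split=> //; rewrite -sbs bsE !size_cat !size_nseq /=; lia.
move=> b1 b2 bsE'.
have [sz|sz] := leqP (size b2) (size bs2).
  left.
  have [s sE] : exists s, bs2 = s ++ b2.
    by apply: cat_split sz; rewrite -/bs' in bsE'; exact: bsE'.
  apply: (lP (nseq k false ++ true :: s)); first by rewrite bsE sE -catA.
right.
have [s sE] : exists s, b2 = s ++ bs2.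
  apply: (@cat_split _ b1 b2 (nseq k.+1 false) bs2); last exact: ltnW.
  by rewrite -bsE'.
have : (count id b1 + count id s = 0)%N.
  by move: cbs'; rewrite bsE' sE !count_cat; lia.
by rewrite sE count_cat; lia.
Qed.

(** * Transition operators *)

Section Operators.
Variables (R : realType) (n : nat) (p lambda : R).
Implicit Types (eta e : config n) (g : config n -> R).

Definition move g eta : R := \sum_M movers_prob p eta M * g (moved eta M).

Definition relocation_mean g e : R :=
  (\sum_(a in e) (\sum_(b in ~: (e :\ a)) g (relocated e a b)) / #|~: (e :\ a)|%:R)
    / #|e|%:R.

Definition perturb g e : R :=
  (1 - pert_prob lambda e) * g e + pert_prob lambda e * relocation_mean g e.

(* One step of the chain is [move (perturb g)]; it splits according to whether
   the state after the movement, before any perturbation, is ideal. *)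
Definition move_nonideal g : config n -> R :=
  move (fun e => if ideal e then 0 else g e).

Definition move_ideal g : config n -> R :=
  move (fun e => if ideal e then perturb g e else 0).

Lemma step_meanE eta g :
  step_mean p lambda eta (fun e _ => g e) = move (perturb g) eta.
Proof. by []. Qed.

Lemma trans_prob_sum eta g :
  \sum_eta' trans_prob p lambda eta eta' * g eta' = move (perturb g) eta.
Proof.
have gE e : g e = \sum_eta' (e == eta')%:R * g eta'.
  rewrite (bigD1 e) //= eqxx mul1r big1 ?addr0 // => e' ne.
  by rewrite eq_sym (negPf ne) mul0r.
rewrite /trans_prob; under eq_bigr do rewrite step_meanE mulr_suml.
rewrite exchange_big /=; apply: eq_bigr => M _.
under eq_bigr do rewrite -mulrA; rewrite -mulr_sumr; congr (_ * _).
set e := moved eta M; rewrite /perturb /relocation_mean.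
under eq_bigr do rewrite mulrDl -!mulrA.
rewrite big_split /= -!mulr_sumr -gE; congr (_ + _ * _).
under [LHS]eq_bigr do rewrite mulr_suml.
rewrite exchange_big /= mulr_suml; apply: eq_bigr => a _.
under [LHS]eq_bigr do rewrite -mulrA mulr_suml.
rewrite exchange_big /= !mulr_suml; apply: eq_bigr => b _.
by rewrite gE !mulr_suml; apply: eq_bigr => e' _; ring.
Qed.

Lemma eq_move g1 g2 eta : (forall e, g1 e = g2 e) -> move g1 eta = move g2 eta.
Proof. by move=> H; apply: eq_bigr => M _; rewrite H. Qed.

Lemma moveD g1 g2 eta : move (fun e => g1 e + g2 e) eta = move g1 eta + move g2 eta.
Proof. by rewrite -big_split; apply: eq_bigr => M _; rewrite mulrDr. Qed.

Lemma moveZ k g eta : move (fun e => k * g e) eta = k * move g eta.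
Proof. by rewrite mulr_sumr; apply: eq_bigr => M _; rewrite mulrCA. Qed.

Lemma perturb_nonideal g e : ~~ ideal e -> perturb g e = g e.
Proof. by move=> /negPf ie; rewrite /perturb /pert_prob ie subr0 mul1r mul0r addr0. Qed.

Lemma move_split g eta :
  move (perturb g) eta = move_nonideal g eta + move_ideal g eta.
Proof.
rewrite -moveD; apply: eq_move => e; case: ifP => ie; rewrite ?add0r ?addr0 //.
by rewrite perturb_nonideal ?ie.
Qed.

Lemma eq_move_nonideal g1 g2 eta : (forall e, g1 e = g2 e) ->
  move_nonideal g1 eta = move_nonideal g2 eta.
Proof. by move=> H; apply: eq_move => e; rewrite H. Qed.

Lemma move_nonidealB g1 g2 eta :
  move_nonideal (fun e => g1 e - g2 e) eta = move_nonideal g1 eta - move_nonideal g2 eta.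
Proof.
rewrite -[- move_nonideal g2 eta]mulN1r -moveZ -moveD; apply: eq_move => e.
by case: ifP; rewrite ?mulr0 ?addr0 // mulN1r.
Qed.

Lemma iter_move_nonidealB k g1 g2 eta :
  iter k move_nonideal (fun e => g1 e - g2 e) eta =
  iter k move_nonideal g1 eta - iter k move_nonideal g2 eta.
Proof.
elim: k eta => // k IH eta.
rewrite !iterS -move_nonidealB; apply: eq_move_nonideal => e; exact: IH.
Qed.

Lemma relocation_mean_le1 g e :
  (forall a b, a \in e -> b \notin e :\ a -> g (relocated e a b) <= 1) ->
  relocation_mean g e <= 1.
Proof.
have le_div (x : R) (k : nat) : x <= k%:R -> x / k%:R <= 1.
  case: k => [|k]; first by rewrite invr0 mulr0 ler01.
  by move=> H; rewrite ler_pdivrMr ?mul1r ?ltr0Sn.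
move=> g1; apply: (le_div _ _).
rewrite -sum1_card natr_sum; apply: ler_sum => a ae; apply: (le_div _ _).
rewrite -sum1_card natr_sum; apply: ler_sum => b; rewrite inE => be; exact: g1.
Qed.

(** Keeping a single term of the double average costs at most a factor [n] for each of the two
    choices. *)
Lemma relocation_mean_ge g e a b :
  (forall a b, a \in e -> b \notin e :\ a -> 0 <= g (relocated e a b)) ->
  a \in e -> b \notin e :\ a ->
  g (relocated e a b) / n%:R ^+ 2 <= relocation_mean g e.
Proof.
move=> g0 ae be.
have n0 : (0 < n)%N by exact: leq_ltn_trans (ltn_ord a).
have le_inv (A : {set 'I_n}) : (0 < #|A|)%N -> n%:R^-1 <= #|A|%:R^-1 :> R.
  move=> A0; rewrite lef_pV2 ?posrE ?ltr0n // ler_nat.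
  by rewrite -[leqRHS]card_ord max_card.
rewrite expr2 invfM mulrA ler_pM ?invr_ge0 ?mulr_ge0 ?g0 ?invr_ge0 //; last first.
  by apply: le_inv; apply/card_gt0P; exists a.
rewrite (bigD1 a) //= ler_wpDr //.
  rewrite sumr_ge0 // => a' /andP[ae' _].
  by rewrite mulr_ge0 ?invr_ge0 // sumr_ge0 // => b'; rewrite inE => be'; exact: g0.
apply: ler_pM; rewrite ?invr_ge0 ?g0 //; last first.
  by apply: le_inv; apply/card_gt0P; exists b; rewrite inE.
rewrite (bigD1 b) /=; last by rewrite inE.
by rewrite ler_wpDr // sumr_ge0 // => b' /andP[]; rewrite inE => be' _; exact: g0.
Qed.

End Operators.

(** * Survival and renewal of the cluster *)

(* Mean of [f] after prepending [k] independent Bernoulli bits to [s]. *)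
Fixpoint bernoulli_mean (R : realType) (p : R) (f : bitseq -> R) k s : R :=
  if k is k'.+1 then
    p * bernoulli_mean p f k' (true :: s) + (1 - p) * bernoulli_mean p f k' (false :: s)
  else f s.

Section GoodStates.
Variables (n m L : nat).
Hypothesis Hn : n = (m + L).+1.
Implicit Types (eta e : config n) (l : 'I_n) (bs : bitseq).
Local Notation goodn := (@good n m L).

(** The case split behind the one-step estimates: either an ideal state, which moves
    deterministically, or a cluster with the box [x] that it swallows next exposed. *)
Lemma goodP eta : (0 < L)%N -> goodn eta ->
  (exists l bs, [/\ size bs = L, (count id bs + 1 = m)%N & eta = st m l bs]) \/
  (exists l bs x, [/\ size (rcons bs x) = L, (1 < m - count id (rcons bs x))%N &
     eta = st m l (rcons bs x)]).
Proof.
move=> L0 [l [bs [sbs cbs E]]].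
have [c1|c1] := leqP (m - count id bs) 1.
  by left; exists l, bs; split=> //; clear -cbs c1; lia.
right; case/lastP: bs sbs cbs E c1 => [|bs x] sbs cbs E c1.
  by move: sbs L0 => /= <-.
by exists l, bs, x.
Qed.

Lemma good_st_cons l bs x b : size (rcons bs x) = L ->
  (1 < m - count id (rcons bs x))%N -> goodn (st m l (b :: bs)).
Proof.
rewrite -cats1 size_cat count_cat => /= sbs c2; exists l, (b :: bs).
by split=> //=; [clear -sbs|clear -c2; case: b]; lia.
Qed.

Lemma good_st_ordS l bs : size bs = L -> (count id bs + 1 = m)%N ->
  goodn (st m (ordS l) bs).
Proof. by move=> sbs cbs; exists (ordS l), bs; split=> //; clear -cbs; lia. Qed.

Lemma good_ideal e : goodn e -> ideal e -> isolated e /\ #|e| = m.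
Proof.
case=> l [bs [sbs cbs ->]]; rewrite (ideal_st Hn) // => c1; split.
  by apply: (st_isolated Hn) => //; lia.
exact: (card_st Hn).
Qed.

Lemma good_gt0 e : goodn e -> (0 < m)%N.
Proof. by case=> l [bs [_ c _]]; exact: leq_ltn_trans c. Qed.

Lemma good_perturb e a b : goodn e -> ideal e -> a \in e -> b \notin e :\ a ->
  goodn (relocated e a b).
Proof.
move=> ge ie ae be; have [iso ce] := good_ideal ge ie.
exact: (good_relocated Hn (good_gt0 ge) iso ce ae be).
Qed.

End GoodStates.

Section Finite.
Variables (R : realType) (n m L : nat) (p : R).
Hypothesis Hn : n = (m + L).+1.
Hypothesis L0 : (0 < L)%N.
Hypothesis p01 : 0 < p < 1.
Implicit Types (eta e : config n) (g : config n -> R) (l : 'I_n) (bs : bitseq).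

Local Notation Q := (@move_nonideal R n p).
Local Notation goodn := (@good n m L).
Let p0 : 0 < p. Proof. by case/andP: p01. Qed.
Let p1 : 0 < 1 - p. Proof. by case/andP: p01 => _; rewrite subr_gt0. Qed.

Let shift l (x : bool) := if x then ord_pred l else l.

Lemma move_st g l bs x : size (rcons bs x) = L -> (1 < m - count id (rcons bs x))%N ->
  move p g (st m l (rcons bs x)) =
    p * g (st m (shift l x) (true :: bs)) + (1 - p) * g (st m (shift l x) (false :: bs)).
Proof.
move=> sbs c2; rewrite /move (sum_movers_st Hn) //; last by lia.
by rewrite !(@moved_st_rcons n m L) //; move: sbs; rewrite size_rcons.
Qed.

Lemma move_st1 g l bs : size bs = L -> (count id bs + 1 = m)%N ->
  move p g (st m l bs) = g (st m (ordS l) bs).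
Proof.
move=> sbs cbs.
have iso : isolated (st m l bs) by exact: (st_isolated Hn).
rewrite /move (@sum_movers_det _ _ _ _ (st m l bs)).
  by rewrite (moved_isolated _ sbs cbs).
by move=> i; exact: jump_isolated iso.
Qed.

Lemma move_nonideal_st g l bs x : size (rcons bs x) = L ->
  (1 < m - count id (rcons bs x))%N ->
  Q g (st m l (rcons bs x)) =
    p * (if (m - count id (true :: bs) <= 1)%N then 0 else g (st m (shift l x) (true :: bs)))
    + (1 - p) * (if (m - count id (false :: bs) <= 1)%N then 0 else g (st m (shift l x)
      (false :: bs))).
Proof.
move=> sbs c2; rewrite /move_nonideal move_st //.
have cx : (count id (rcons bs x) = count id bs + x)%N.
  by rewrite -cats1 count_cat /= addn0.
by rewrite !(ideal_st Hn) //=; move: sbs c2; rewrite ?cx ?size_rcons //; lia.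
Qed.

Lemma move_nonideal_st1 g l bs : size bs = L -> (count id bs + 1 = m)%N ->
  Q g (st m l bs) = 0.
Proof.
move=> sbs cbs; rewrite /move_nonideal move_st1 // (ideal_st Hn) //; last by lia.
by rewrite ifT //; lia.
Qed.

Lemma le_move g1 g2 eta : goodn eta -> (forall e, goodn e -> g1 e <= g2 e) ->
  move p g1 eta <= move p g2 eta.
Proof.
case/(goodP L0) => [[l [bs [sbs cbs ->]]]|[l [bs [x [sbs c2 ->]]]]] H.
  by rewrite !move_st1 //; apply: H; exact: good_st_ordS.
rewrite !move_st //; apply: lerD; rewrite ler_pM2l //; apply: H; exact: good_st_cons c2.
Qed.

Lemma move_cst c eta : goodn eta -> move p (fun=> c) eta = c.
Proof.
case/(goodP L0) => [[l [bs [sbs cbs ->]]]|[l [bs [x [sbs c2 ->]]]]].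
  by rewrite move_st1.
by rewrite move_st // -mulrDl addrC subrK mul1r.
Qed.

Definition unit_on_good g := forall e, goodn e -> 0 <= g e <= 1.

Lemma unit_move_nonideal g : unit_on_good g -> unit_on_good (Q g).
Proof.
move=> H eta ge; apply/andP; split.
  rewrite -[leLHS](move_cst 0 ge); apply: le_move => // e /H /andP[? ?].
  by case: ifP.
rewrite -[leRHS](move_cst 1 ge); apply: le_move => // e /H /andP[? ?].
by case: ifP.
Qed.

Lemma unit_iter k g : unit_on_good g -> unit_on_good (iter k Q g).
Proof. by move=> H; elim: k => //= k; exact: unit_move_nonideal. Qed.

Lemma bernoulli_mean_ge0 (phi : bitseq -> R) k s : (forall bs, 0 <= phi bs) ->
  0 <= bernoulli_mean p phi k s.
Proof.
by move=> phi0; elim: k s => //= j IH s; rewrite addr_ge0 // mulr_ge0 // ltW.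
Qed.

(** After [k] steps the word consists of [k] fresh bits followed by the first [L - k] old boxes, the
    others having been swallowed. Killed paths contribute 0, which the nonnegative [phi] dominates,
    so the fresh bits need not be conditioned on survival. *)
Lemma iter_move_nonideal_le (phi : bitseq -> R) g k l bs :
  (forall bs, 0 <= phi bs) ->
  (forall l bs, size bs = L -> (1 < m - count id bs)%N -> g (st m l bs) <= phi bs) ->
  (k <= L)%N -> size bs = L -> (1 < m - count id bs)%N ->
  iter k Q g (st m l bs) <= bernoulli_mean p phi k (take (L - k) bs).
Proof.
move=> phi0 gphi.
elim: k l bs => [|k IH] l bs kL sbs c2.
  by rewrite subn0 -sbs take_size /= gphi.
case/lastP: bs sbs c2 => [|bs x] sbs c2; first by move: sbs kL => /= <-.
rewrite iterS move_nonideal_st //=.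
have tE : take (L - k.+1) (rcons bs x) = take (L - k.+1) bs.
  by rewrite -cats1 takel_cat //; move: sbs; rewrite size_rcons; lia.
have tE' b : take (L - k) (b :: bs) = b :: take (L - k.+1) (rcons bs x).
  by rewrite (_ : (L - k = (L - k.+1).+1)%N) /= ?tE //; lia.
have sbs' b : size (b :: bs) = L by rewrite -sbs size_rcons.
apply: lerD; rewrite ler_pM2l //; (case: ifPn => c2'; first exact: bernoulli_mean_ge0);
  rewrite -tE'; apply: IH; rewrite ?sbs' //=; lia.
Qed.

(** After a full round no old box is left, so the bound does not depend on the initial state. *)
Lemma iter_move_nonideal_good (phi : bitseq -> R) g eta :
  (forall bs, 0 <= phi bs) ->
  (forall l bs, size bs = L -> (1 < m - count id bs)%N -> g (st m l bs) <= phi bs) ->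
  goodn eta -> iter L Q g eta <= bernoulli_mean p phi L [::].
Proof.
move=> phi0 gphi /(goodP L0)[[l [bs [sbs cbs ->]]]|[l [bs [x [sbs c2 ->]]]]].
  rewrite -(prednK L0) iterS move_nonideal_st1 ?prednK //.
  exact: bernoulli_mean_ge0.
have := @iter_move_nonideal_le phi g L l _ phi0 gphi (leqnn L) sbs c2.
by rewrite subnn take0.
Qed.

(* [expR (- (theta * w))], with [w] a lower bound of the distance to extinction
   when the drift is [p'], is a supermartingale that is at least 1 at extinction. *)
Lemma survive_ge (theta p' w : R) k l bs : 0 < theta ->
  p * expR theta + (1 - p) <= expR (theta * p') ->
  (k <= L)%N -> size bs = L -> (1 < m - count id bs)%N ->
  (forall t, (t <= k)%N ->
    w + p' * t%:R <= (m - count id bs)%:R + (count id (drop (L - t) bs))%:R - 1) ->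
  1 - expR (- (theta * w)) <= iter k Q (fun=> 1) (st m l bs).
Proof.
move=> th0 Hth; elim: k w l bs => [|k IH] w l bs kL sbs c2 H.
  by rewrite /= gerBl expR_ge0.
case/lastP: bs sbs c2 H => [|bs x] sbs c2 H; first by move: sbs kL => /= <-.
rewrite iterS move_nonideal_st //.
have sbs1 : (size bs).+1 = L by rewrite -sbs size_rcons.
have cx : count id (rcons bs x) = (count id bs + x)%N by rewrite -cats1 count_cat /= addn0.
(* A step loses [b] and uses up one unit of time, in which the hypothesis grants the drift [p']: the
   bound [w] on the distance becomes [w + p' - b]. *)
have step (b : bool) : 1 - expR (- (theta * (w + p' - b%:R))) <=
    if (m - count id (b :: bs) <= 1)%N then 0
    else iter k Q (fun=> 1) (st m (shift l x) (b :: bs)).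
  have key t : (t <= k)%N ->
      (w + p' - b%:R) + p' * t%:R <=
      (m - count id (b :: bs))%:R + (count id (drop (L - t) (b :: bs)))%:R - 1.
    move=> tk; have := H t.+1 tk.
    rewrite (_ : drop (L - t) (b :: bs) = drop (L - t.+1) bs); last first.
      by rewrite (_ : (L - t = (L - t.+1).+1)%N) //; lia.
    rewrite drop_rcons; last by lia.
    rewrite cx -(cats1 (drop _ _)) count_cat /= addn0 -[t.+1%:R]natr1.
    have c2' : (b + count id bs <= m)%N by move: c2; rewrite cx; case: (b) => /=; lia.
    have c2'' : (count id bs + x <= m)%N by move: c2; rewrite cx; lia.
    rewrite !natrB // !natrD; lra.
  (* At extinction the case [t = 0] forces the new distance to be nonpositive, so the claimed lower
     bound is at most 0. *)
  case: ifPn => c'.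
    have := key 0%N isT; rewrite mulr0 addr0 subn0 -sbs1 -[(size bs).+1]/(size (b :: bs))
      drop_size /= addr0.
    move=> w'; have w'0 : w + p' - b%:R <= 0.
      apply: le_trans w' _; rewrite subr_le0; rewrite -[1]/(1%:R) ler_nat; exact: c'.
    by rewrite subr_le0 -[1 in leLHS]expR0 ler_expR oppr_ge0 mulr_ge0_le0 // ltW.
  by apply: IH; [exact: ltnW|exact: sbs1|rewrite ltnNge|exact: key].
have s1 : 1 - expR (- (theta * (w + p' - 1))) <= _ := step true; have s0 := step false.
rewrite -(ler_pM2l p0) in s1; rewrite -(ler_pM2l p1) in s0.
apply: le_trans (lerD s1 s0).
rewrite subr0.
have -> : expR (- (theta * (w + p' - 1))) = expR (- (theta * w)) * (expR (- (theta * p')) *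
  expR theta).
  by rewrite -!expRD; congr expR; ring.
have -> : expR (- (theta * (w + p'))) = expR (- (theta * w)) * expR (- (theta * p')).
  by rewrite -!expRD; congr expR; ring.
have : expR (- (theta * p')) * (p * expR theta + (1 - p)) <= 1.
  rewrite -[leRHS]expR0 -(addNr (theta * p')) expRD ler_pM2l ?expR_gt0 //.
have := expR_ge0 (- (theta * w)).
nra.
Qed.

Variable lambda : R.
Hypothesis lambda_n : 0 <= lambda <= n%:R.

Lemma pert_prob01 e : 0 <= pert_prob lambda e <= 1.
Proof.
rewrite /pert_prob; case: ifP => _; rewrite ?lexx ?ler01 //.
case/andP: lambda_n => l0 ln; rewrite divr_ge0 //= ler_pdivrMr ?mul1r //.
by rewrite ltr0n Hn.
Qed.

Lemma perturb_le1 g e : unit_on_good g -> goodn e -> ideal e -> perturb lambda g e <= 1.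
Proof.
move=> H ge ie; rewrite /perturb.
have /andP[q0 q1] := pert_prob01 e.
have /andP[g0 g1] := H e ge.
have : relocation_mean g e <= 1.
  by apply: relocation_mean_le1 => a b ae be; case/andP: (H _ (good_perturb Hn ge ie ae be)).
nra.
Qed.

(** The cycle lemma alone gives the new pair the initial distance 0. The factor [1 - p] pays for a
    first step in which the pair loses nothing; this raises the distance to [p'] and makes the
    survival bound positive. *)
Lemma perturb_ge (theta p' : R) e : 0 < theta -> (1 < m)%N ->
  p * expR theta + (1 - p) <= expR (theta * p') ->
  p' <= m%:R / L.+1%:R -> p' * L%:R <= m%:R - 1 ->
  goodn e -> ideal e ->
  lambda * (1 - p) * (1 - expR (- (theta * p'))) / n%:R ^+ 3 <=
    perturb lambda (iter L Q (fun=> 1)) e.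
Proof.
move=> th0 m1 Hth p'a p'm ge ie.
have [iso ce] := good_ideal Hn ge ie.
have [a [b [l [bs [ae be relE [sbs cbs] bsP]]]]] := good_start R Hn iso ce m1.
have uQ : unit_on_good (iter L Q (fun=> 1)) by apply: unit_iter => ? _; rewrite ler01 lexx.
have := @relocation_mean_ge _ _ (iter L Q (fun=> 1)) e a b _ ae be.
rewrite relE; set q := iter L _ _ (st m l bs) => Hq.
have {}Hq : q / n%:R ^+ 2 <= relocation_mean (iter L Q (fun=> 1)) e.
  by apply: Hq => a' b' ae' be'; case/andP: (uQ _ (good_perturb Hn ge ie ae' be')).
have qge : (1 - p) * (1 - expR (- (theta * p'))) <= q.
  rewrite /q; case/lastP: bs sbs cbs bsP {relE q Hq} => [|bs x] sbs cbs bsP.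
    by move: L0; rewrite -sbs.
  have sbs1 : (size bs).+1 = L by rewrite -sbs size_rcons.
  have cx : count id (rcons bs x) = (count id bs + x)%N by rewrite -cats1 count_cat /= addn0.
  have c2 : (1 < m - count id (false :: bs))%N by move: cbs; rewrite cx /=; clear; lia.
  have c2b : (1 < m - count id (rcons bs x))%N by clear -cbs; lia.
  have -> : iter L Q (fun=> 1) = Q (iter L.-1 Q (fun=> 1)) by rewrite -iterS prednK.
  rewrite move_nonideal_st //.
  rewrite ler_wpDl //.
    rewrite mulr_ge0 ?(ltW p0) //; case: ifP => // _.
    have ux : unit_on_good (iter L.-1 Q (fun=> 1)) by apply: unit_iter => ? _;
      rewrite ler01 lexx.
    by case/andP: (ux _ (good_st_cons (shift l x) true sbs c2b)).
  rewrite ler_pM2l // ifN -?ltnNge //.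
  apply: (@survive_ge theta p' p') => //; first exact: leq_pred.
  move=> t tL.
  rewrite (_ : drop (L - t) (false :: bs) = drop (L - t.+1) bs); last first.
    by rewrite (_ : (L - t = (L - t.+1).+1)%N) //; clear -tL L0; lia.
  have := bsP _ _ (esym (cat_take_drop (L - t.+1) (rcons bs x))).
  rewrite size_drop size_rcons sbs1 (_ : (L - (L - t.+1) = t.+1)%N); last by clear -tL L0; lia.
  rewrite drop_rcons; last by clear -tL sbs1; lia.
  rewrite -(cats1 (drop _ _)) count_cat /= addn0.
  have cb : (m - count id bs = 2 + x)%N by move: cbs; rewrite cx /=; clear; lia.
  rewrite [(m - _)%N](_ : _ = (2 + x)%N); last exact: cb.
  rewrite -(natr1 t) !natrD.
  have t0 : 0 <= t%:R :> R by [].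
  have tL1 : t%:R + 1 <= L%:R :> R by rewrite natr1 ler_nat; clear -tL L0; lia.
  have p'0 : 0 < p'.
    rewrite -(pmulr_rgt0 _ th0) -expR_gt1; apply: lt_le_trans Hth.
    have : 1 < expR theta by rewrite expR_gt1.
    by move: p0 p1; nra.
  (* Either the cycle bound applies and [p'] is at most the density, or all other particles have
     been swallowed and [p' * L <= m - 1] suffices. *)
  case=> [H|H].
    have := le_trans (ler_wpM2r (addr_ge0 t0 ler01) p'a) (_ : _ <= 1 + ((count id (drop (L -
      t.+1) bs))%:R + x%:R)).
    by rewrite -lerBlDl => /(_ H); rewrite mulrDr mulr1; lra.
  have {}H : (count id (drop (L - t.+1) bs))%:R + x%:R + 2 = m%:R :> R.
    by rewrite -H !natrD.
  nra.
have /andP[pp0 pp1] := pert_prob01 e.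
have /andP[g0 g1] := uQ _ ge.
rewrite /perturb; apply: le_trans (_ : _ <= pert_prob lambda e * (q / n%:R ^+ 2)) _; last first.
  by rewrite ler_wpDl ?mulr_ge0 ?subr_ge0 // ler_wpM2l.
rewrite /pert_prob ie.
have -> : lambda / n%:R * (q / n%:R ^+ 2) = lambda / n%:R ^+ 3 * q.
  have e3 : (n%:R ^+ 3)^-1 = n%:R^-1 * (n%:R ^+ 2)^-1 :> R by rewrite -invfM -exprS.
  rewrite e3; move: (_ ^+ 2)^-1 => z; ring.
have -> : lambda * (1 - p) * (1 - expR (- (theta * p'))) / n%:R ^+ 3 =
    lambda / n%:R ^+ 3 * ((1 - p) * (1 - expR (- (theta * p')))) by ring.
apply: ler_wpM2l => //; rewrite divr_ge0 ?exprn_ge0 //.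
by case/andP: lambda_n.
Qed.

End Finite.

(** * Birth and death rates in equilibrium *)

Section Stationary.
Variables (R : realType) (n m L : nat) (p lambda : R).
Hypothesis Hn : n = (m + L).+1.
Hypothesis L0 : (0 < L)%N.
Hypothesis p01 : 0 < p < 1.
Hypothesis lambda_n : 0 <= lambda <= n%:R.
Variable nu : config n -> R.
Hypothesis nu_ge0 : forall eta, 0 <= nu eta.
Hypothesis nu_good : forall eta, nu eta != 0 -> good m L eta.
Hypothesis nu_stat : forall eta', \sum_eta nu eta * trans_prob p lambda eta eta' = nu eta'.
Implicit Types g : config n -> R.

Local Notation Q := (@move_nonideal R n p).

Definition mean g : R := \sum_eta nu eta * g eta.

Lemma mean_stat g : mean g = mean (move p (perturb lambda g)).
Proof.
rewrite /mean; under eq_bigr do rewrite -nu_stat mulr_suml.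
rewrite exchange_big /=; apply: eq_bigr => eta _.
by rewrite -trans_prob_sum mulr_sumr; apply: eq_bigr => eta' _; rewrite mulrA.
Qed.

Lemma le_mean g1 g2 : (forall eta, good m L eta -> g1 eta <= g2 eta) ->
  mean g1 <= mean g2.
Proof.
move=> H; apply: ler_sum => eta _.
have [->|/nu_good ge] := eqVneq (nu eta) 0; first by rewrite !mul0r.
by rewrite ler_wpM2l // H.
Qed.

Lemma meanD g1 g2 : mean (fun eta => g1 eta + g2 eta) = mean g1 + mean g2.
Proof. by rewrite -big_split; apply: eq_bigr => eta _; rewrite mulrDr. Qed.

Lemma meanZ k g : mean (fun eta => k * g eta) = k * mean g.
Proof. by rewrite mulr_sumr; apply: eq_bigr => eta _; rewrite mulrCA. Qed.

(** Equilibrium probability that a movement ends in an ideal state, before any perturbation;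
    clusters that dissolve and ideal states that persist both count. *)
Definition ideal_rate : R := mean (move p (fun e => (ideal e)%:R)).

Lemma mean_iterS k g : unit_on_good m L g ->
  mean (iter k Q g) <= ideal_rate + mean (iter k.+1 Q g).
Proof.
move=> ug; rewrite mean_stat -meanD; apply: le_mean => eta ge.
rewrite move_split addrC iterS lerD2r.
apply: (le_move Hn L0 p01) => // e he; case: ifP => // ie.
apply: (perturb_le1 Hn lambda_n) => //; exact: (unit_iter Hn L0 p01).
Qed.

(** Looking back [k] steps, either some movement ended in an ideal state, which costs at most
    [ideal_rate] per step since [g] is at most 1, or the cluster survived them all. *)
Lemma mean_le_iter k g : unit_on_good m L g ->
  mean g <= k%:R * ideal_rate + mean (iter k Q g).
Proof.
move=> ug; elim: k => [|k IH]; first by rewrite mul0r add0r.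
apply: le_trans IH _; rewrite -natr1 mulrDl mul1r -addrA lerD2l.
exact: mean_iterS.
Qed.

(* In equilibrium, clusters that survive [L] steps after their birth appear
   at the same rate as clusters that are at least [L] steps old dissolve. *)
Lemma birth_death (q : R) :
  (forall e, good m L e -> ideal e -> q <= perturb lambda (iter L Q (fun=> 1)) e) ->
  q * ideal_rate <= mean (iter L Q (fun eta => 1 - Q (fun=> 1) eta)).
Proof.
move=> Hq.
(* Stationarity is applied to the survival function [iter L Q (fun=> 1)]. The nonideal part of the
   step is [iter L.+1 Q (fun=> 1)], which cancels. *)
have -> : mean (iter L Q (fun eta => 1 - Q (fun=> 1) eta)) =
    mean (move_ideal p lambda (iter L Q (fun=> 1))).
  rewrite /mean; under eq_bigr do rewrite iter_move_nonidealB -iterSr mulrBr.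
  rewrite big_split /= sumrN -!/(mean _) mean_stat -/(mean _).
  under [X in mean X]funext do rewrite move_split -iterS.
  by rewrite meanD addrAC subrr add0r.
rewrite -meanZ; apply: le_mean => eta ge; rewrite -moveZ.
apply: (le_move Hn L0 p01) => // e he; case: ifP => ie; last by rewrite mulr0.
by rewrite mulr1 Hq.
Qed.

(** A cluster loses at most one particle per step, so only a pair can dissolve in the next step;
    hence [phi0] has to dominate 1 on pairs only. *)
Lemma stationary_bound (phi phi0 : bitseq -> R) (q : R) g :
  unit_on_good m L g ->
  (forall bs, 0 <= phi bs) -> (forall bs, 0 <= phi0 bs) ->
  (forall l bs, size bs = L -> (1 < m - count id bs)%N -> g (st m l bs) <= phi bs) ->
  (forall bs, size bs = L -> (count id bs + 2 = m)%N -> 1 <= phi0 bs) ->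
  0 < q ->
  (forall e, good m L e -> ideal e -> q <= perturb lambda (iter L Q (fun=> 1)) e) ->
  0 <= ideal_rate /\ mean g <= L%:R * ideal_rate + mean (fun=> bernoulli_mean p phi L [::]) /\
  q * ideal_rate <= mean (fun=> bernoulli_mean p phi0 L [::]).
Proof.
move=> ug phi_ge0 phi0_ge0 gphi phi0_ge1 q0 Hq; split; [|split].
- rewrite -[leLHS](_ : mean (fun=> 0) = 0); last by rewrite /mean big1 // => e _; rewrite mulr0.
  apply: le_mean => eta ge; rewrite -[leLHS](move_cst Hn L0 p01 0 ge).
  exact: (le_move Hn L0 p01).
- apply: le_trans (mean_le_iter L ug) _; rewrite lerD2l; apply: le_mean => eta.
  exact: (iter_move_nonideal_good Hn L0 p01).
apply: le_trans (birth_death Hq) _; apply: le_mean => eta.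
apply: (iter_move_nonideal_good Hn L0 p01) => // l bs sbs c2.
case/lastP: bs sbs c2 => [|bs x] sbs c2; first by move: L0; rewrite -sbs.
rewrite (move_nonideal_st Hn L0 p01) //.
have cx : count id (rcons bs x) = (count id bs + x)%N by rewrite -cats1 count_cat /= addn0.
have [c3|c3] := eqVneq (count id (rcons bs x) + 2)%N m.
  apply: le_trans (phi0_ge1 _ sbs c3).
  case/andP: p01 => p0 p1.
  by rewrite gerBl addr_ge0 // mulr_ge0 ?subr_ge0 ?(ltW p0) ?(ltW p1) //; case: ifP.
rewrite !ifN; last 2 first.
- by rewrite -ltnNge /=; move: c2 c3; rewrite cx; case: (x) => /=; lia.
- by rewrite -ltnNge /=; move: c2 c3; rewrite cx; case: (x) => /=; lia.
by rewrite !mulr1 addrCA subrr addr0 subrr.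
Qed.

End Stationary.

(** * Chernoff bound and concentration *)

Section Chernoff.
Variables (R : realType) (p : R).
Hypothesis p01 : 0 < p < 1.

(** From [expR x <= 1 / (1 - x)], as [(1 + x + 2 x^2) (1 - x) = 1 + x^2 (1 - 2 x)]. *)
Lemma expR_le_quad (x : R) : x <= 1 / 2 -> expR x <= 1 + x + 2 * x ^+ 2.
Proof.
move=> x1; have h := expR_ge1Dx (- x).
have : expR x * (1 - x) <= 1.
  by rewrite -[leRHS](expRxMexpNx_1 x) ler_pM2l ?expR_gt0.
have := expR_gt0 x; nra.
Qed.

Lemma bernoulli_mgf (theta : R) : - (1 / 2) <= theta <= 1 / 2 ->
  p * expR (theta * (1 - p)) + (1 - p) * expR (- (theta * p)) <= expR (2 * theta ^+ 2).
Proof.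
move=> /andP[t1 t2]; have /andP[p0 p1] := p01.
have h1 : expR (theta * (1 - p)) <= 1 + theta * (1 - p) + 2 * (theta * (1 - p)) ^+ 2.
  by apply: expR_le_quad; nra.
have h2 : expR (- (theta * p)) <= 1 - theta * p + 2 * (- (theta * p)) ^+ 2.
  by apply: expR_le_quad; nra.
have h3 := expR_ge1Dx (2 * theta ^+ 2).
apply: le_trans h3.
have p1' : 0 <= 1 - p by lra.
apply: le_trans (lerD (ler_wpM2l (ltW p0) h1) (ler_wpM2l p1' h2)) _.
have : theta ^+ 2 * (p * (1 - p)) <= theta ^+ 2 * 1.
  by apply: ler_wpM2l; [exact: sqr_ge0|nra].
nra.
Qed.

Lemma bernoulli_drift (p' : R) : p < p' < 1 -> exists2 theta : R, 0 < theta &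
  p * expR theta + (1 - p) <= expR (theta * p').
Proof.
move=> /andP[pp' p'1]; have /andP[p0 p1] := p01.
(* Chosen so that [2 * theta ^+ 2 = theta * (p' - p)]. *)
exists ((p' - p) / 2); first by lra.
set theta := _ / 2.
have : p * expR (theta * (1 - p)) + (1 - p) * expR (- (theta * p)) <= expR (2 * theta ^+ 2).
  by apply: bernoulli_mgf; rewrite /theta; lra.
have -> : expR theta = expR (theta * p) * expR (theta * (1 - p)).
  by rewrite -expRD; congr expR; ring.
have -> : expR (theta * p') = expR (theta * p) * expR (2 * theta ^+ 2).
  by rewrite -expRD; congr expR; rewrite /theta; field.
have e1 : (1 - p) * (expR (theta * p) * expR (- (theta * p))) = 1 - p.
  by rewrite expRxMexpNx_1 mulr1.
by move=> /(ler_wpM2l (expR_ge0 (theta * p))); lra.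
Qed.

Local Notation EB := (bernoulli_mean p).

Lemma le_bernoulli_mean (f g : bitseq -> R) k s : (forall bs, f bs <= g bs) ->
  EB f k s <= EB g k s.
Proof.
have /andP[p0 p1] := p01.
by move=> H; elim: k s => //= k IH s; rewrite lerD // ler_wpM2l ?IH // ?subr_ge0 ltW.
Qed.

Lemma bernoulli_meanD (f g : bitseq -> R) k s :
  EB (fun bs => f bs + g bs) k s = EB f k s + EB g k s.
Proof. by elim: k s => //= k IH s; rewrite !IH; ring. Qed.

Lemma bernoulli_meanZ (f : bitseq -> R) c k s :
  EB (fun bs => c * f bs) k s = c * EB f k s.
Proof. by elim: k s => //= k IH s; rewrite !IH; ring. Qed.

Lemma bernoulli_mean_sum (f : nat -> bitseq -> R) N k s :
  EB (fun bs => \sum_(j < N) f j bs) k s = \sum_(j < N) EB (f j) k s.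
Proof.
elim: k s => //= k IH s; rewrite !IH !mulr_sumr -big_split //=.
Qed.

Lemma bernoulli_mean_le_cst (f : bitseq -> R) c k s :
  (forall s, f s <= c) -> EB f k s <= c.
Proof.
have /andP[p0 p1] := p01.
move=> H; elim: k s => //= k IH s; have := IH (true :: s); have := IH (false :: s); nra.
Qed.

Lemma bernoulli_mean_add (f : bitseq -> R) k1 k2 s :
  EB f (k1 + k2) s = EB (EB f k2) k1 s.
Proof. by elim: k1 s => //= k1 IH s; rewrite !IH. Qed.

Let dev j (bs : bitseq) : R := (count id (take j bs))%:R - p * j%:R.

Lemma bernoulli_mean_exp (theta : R) j s : - (1 / 2) <= theta <= 1 / 2 ->
  EB (fun bs => expR (theta * dev j bs)) j s <= expR (2 * theta ^+ 2 * j%:R).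
Proof.
move=> th.
(* With [i] bits still to be prepended, only the first [j - i] letters of [s'] will stay within the
   prefix of length [j]. *)
suff H i s' : (i <= j)%N -> EB (fun bs => expR (theta * dev j bs)) i s' <=
    expR (2 * theta ^+ 2 * i%:R) * expR (theta * dev (j - i) s').
  apply: le_trans (H j s (leqnn j)) _.
  by rewrite subnn /dev take0 /= mulr0 subrr mulr0 expR0 mulr1.
elim: i s' => [|i IH] s' ij; first by rewrite mulr0 expR0 mul1r subn0.
have devE (b : bool) : dev (j - i) (b :: s') = dev (j - i.+1) s' + (b%:R - p).
  rewrite /dev (_ : (j - i = (j - i.+1).+1)%N); last by lia.
  by rewrite /= natrD -natr1; ring.
have /andP[p0 p1] := p01; have p1' : 0 <= 1 - p by lra.
have h1 := ler_wpM2l (ltW p0) (IH (true :: s') (ltnW ij)).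
have h0 := ler_wpM2l p1' (IH (false :: s') (ltnW ij)).
apply: le_trans (lerD h1 h0) _.
have -> : expR (theta * dev (j - i) (true :: s')) =
    expR (theta * dev (j - i.+1) s') * expR (theta * (1 - p)).
  by rewrite devE -expRD; congr expR; rewrite mulrDr.
have -> : expR (theta * dev (j - i) (false :: s')) =
    expR (theta * dev (j - i.+1) s') * expR (- (theta * p)).
  by rewrite devE -expRD; congr expR; rewrite /= sub0r mulrDr mulrN.
rewrite -[i.+1%:R]natr1 [_ * (_ + 1)]mulrDr mulr1 expRD.
have := ler_wpM2l (mulr_ge0 (expR_ge0 (2 * theta ^+ 2 * i%:R))
  (expR_ge0 (theta * dev (j - i.+1) s'))) (bernoulli_mgf th).
lra.
Qed.

Definition atypical L (D : R) (bs : bitseq) : bool :=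
  [exists j : 'I_L.+1, D < `|(count id (take j bs))%:R - p * j%:R|].

(** Exponential Markov inequality with a union bound over the [L.+1] prefixes and the two signs,
    whence the factor [2 * N]. *)
Lemma atypical_bound L (delta N : R) : 0 < delta <= 2 -> L.+1%:R <= N ->
  EB (fun bs => (atypical L (delta * N) bs)%:R) L [::] <=
    2 * N * expR (- (delta ^+ 2 / 8 * N)).
Proof.
move=> /andP[d0 d2] LN.
(* Minimizes the exponent [- theta * delta * N + 2 * theta ^+ 2 * N], with value
   [- (delta ^+ 2 / 8 * N)]. *)
pose theta := delta / 4; pose D := delta * N.
pose f j bs := expR (- (theta * D)) * (expR (theta * dev j bs) + expR (- theta * dev j bs)).
apply: le_trans (_ : _ <= EB (fun bs => \sum_(j < L.+1) f j bs) L [::]) _.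
  apply: le_bernoulli_mean => bs; rewrite /atypical.
  have f0 j : 0 <= f j bs by rewrite mulr_ge0 ?addr_ge0 ?expR_ge0.
  case: existsP => [[j Hj]|_]; last by rewrite sumr_ge0.
  rewrite (bigD1 j) //= ler_wpDr ?sumr_ge0 // /f mulrDr -!expRD.
  have th0 : 0 < theta by rewrite /theta; lra.
  have := Hj; rewrite -/D lter_normr -/(dev j bs) => /orP[H|H].
    rewrite ler_wpDr ?expR_ge0 // -[leLHS]expR0 ler_expR -mulrN -mulrDr pmulr_rge0 //; lra.
  rewrite ler_wpDl ?expR_ge0 // -[leLHS]expR0 ler_expR mulNr -mulrN -mulrN -mulrDr pmulr_rge0
    //; lra.
rewrite bernoulli_mean_sum.
have N0 : 0 <= N by apply: le_trans LN.
apply: le_trans (_ : _ <= \sum_(j < L.+1) 2 * expR (- (delta ^+ 2 / 8 * N))) _; last first.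
  by rewrite sumr_const card_ord -[_ *+ L.+1]mulr_natr -!mulrA ler_pM2l // mulrC ler_wpM2r
    ?expR_ge0.
apply: ler_sum => j _; rewrite /f bernoulli_meanZ bernoulli_meanD.
have jL : (j <= L)%N by rewrite -ltnS.
have key (th : R) : th = theta \/ th = - theta ->
    EB (fun bs => expR (th * dev j bs)) L [::] <= expR (delta ^+ 2 / 8 * N).
  (* The last [j] bits drawn form the prefix of length [j]; those drawn earlier only make up the
     tail [s]. *)
  move=> Hth; have LE : L = (L - j + j)%N by rewrite subnK.
  rewrite [X in EB _ X _]LE bernoulli_mean_add.
  apply: bernoulli_mean_le_cst => s.
  apply: le_trans (bernoulli_mean_exp _ _ _) _.
    by case: Hth => ->; rewrite /theta; lra.
  rewrite ler_expR.
  have -> : th ^+ 2 = delta ^+ 2 / 16 by case: Hth => ->; rewrite /theta; field.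
  have : j%:R <= N by apply: le_trans LN; rewrite ler_nat ltnW.
  move=> jN; have : delta ^+ 2 / 8 * j%:R <= delta ^+ 2 / 8 * N.
    by rewrite ler_wpM2l // divr_ge0 ?sqr_ge0.
  lra.
have k1 := key theta (or_introl erefl); have k2 := key (- theta) (or_intror erefl).
have -> : - (delta ^+ 2 / 8 * N) = - (theta * D) + delta ^+ 2 / 8 * N.
  by rewrite /theta /D; field.
rewrite expRD; have := ler_wpM2l (expR_ge0 (- (theta * D))) (lerD k1 k2); lra.
Qed.

End Chernoff.

(** Ideal states count as untypical as well, through the condition [1 < m - count id bs]. *)
Definition untypical (R : realType) (p D : R) n m (eta : config n) : bool :=
  ~~ [exists l : 'I_n, exists bs : (n - m).-1.-tuple bool,
      [&& (1 < m - count id bs)%N, ~~ atypical p (n - m).-1 D bs & eta == st m l bs]].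

(** Sixth power of [y <= expR y] at [y = k * x / 6]. The exponent 6 collects three powers of [n]
    from the birth rate, one from the union bound, one from the length of a round, and one to spare
    for the limit. *)
Lemma exp_decay (R : realType) (k x : R) : 0 < k -> 0 <= x ->
  x ^+ 6 * expR (- (k * x)) <= (6 / k) ^+ 6.
Proof.
move=> k0 x0.
have k1 : k * x / 6 <= expR (k * x / 6).
  by apply: le_trans (expR_ge1Dx _); rewrite lerDr.
have k2 : x <= 6 / k * expR (k * x / 6).
  rewrite -(ler_pM2l k0) mulrA mulrCA divff ?lt0r_neq0 // mulr1; lra.
have k3 : x ^+ 6 <= (6 / k) ^+ 6 * expR (k * x).
  have -> : expR (k * x) = expR (k * x / 6) ^+ 6.
    by rewrite -expRM_natl; congr expR; field.
  rewrite -exprMn lerXn2r ?nnegrE // mulr_ge0 ?expR_ge0 // divr_ge0 // ltW //.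
rewrite -(ler_pM2r (expR_gt0 (k * x))) -mulrA [expR (- _) * _]mulrC expRxMexpNx_1 mulr1 //.
Qed.

Lemma nparticles_bounds (R : realType) (rho : R) n : 0 <= rho ->
  rho * n%:R <= (nparticles rho n)%:R < rho * n%:R + 1.
Proof.
move=> r0; have rn0 : 0 <= rho * n%:R by rewrite mulr_ge0.
have c0 : (0 <= Num.ceil (rho * n%:R))%R.
  by rewrite -(ler_int R) (le_trans rn0) // ceil_ge.
have -> : (nparticles rho n)%:R = (Num.ceil (rho * n%:R))%:~R :> R.
  by rewrite /nparticles -[RHS]/(_%:~R) -[in RHS](gez0_abs c0).
by rewrite ceil_ge /= -ltrBlDr; have := ceilB1_lt (rho * n%:R); rewrite intrB.
Qed.

Section Concentration.
Variables (R : realType) (p rho : R).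
Hypothesis p01 : 0 < p < 1.
Hypothesis prho : p * (1 - rho) < rho.
Hypothesis rho2 : rho < 1 / 2.

Let rho0 : 0 < rho. Proof.
have /andP[p0 p1] := p01.
rewrite ltNge; apply/negP => r0.
have : p * rho <= 0 by rewrite pmulr_rle0.
have := prho; lra.
Qed.

Lemma near_dims : \forall n \near \oo, let m := nparticles rho n in
  [/\ (1 < m)%N, (0 < (n - m).-1)%N & n = (m + (n - m).-1).+1].
Proof.
near=> n => m.
have h2 := rho2; have h3 := rho0.
have /andP[m1 m2] := nparticles_bounds n (ltW rho0).
have X1 : 6 <= n%:R :> R by near: n; exact: nbhs_infty_ger.
have X2 : 2 / rho <= n%:R :> R by near: n; exact: nbhs_infty_ger.
have m2' : (2 <= m)%N.
  by rewrite -(ler_nat R) (le_trans _ m1) // mulrC -ler_pdivrMr.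
have mn : (m + 2 <= n)%N by rewrite -(ler_nat R) natrD /m; nra.
by split; lia.
Unshelve. all: end_near. Qed.

Variable lambda : R.

(** All that is used of a stationary distribution; the chain of configurations and the configuration
    marginal of the extended chain both provide it. *)
Definition stationary_good n (nu : config n -> R) : Prop :=
  [/\ forall eta, 0 <= nu eta, \sum_eta nu eta = 1,
      forall eta, nu eta != 0 -> good (nparticles rho n) (n - nparticles rho n).-1 eta
    & forall eta', \sum_eta nu eta * trans_prob p lambda eta eta' = nu eta'].

Hypothesis lambda0 : 0 < lambda.

Lemma concentration (delta eps : R) : 0 < delta <= 2 -> 0 < eps ->
  \forall n \near \oo, forall nu : config n -> R, stationary_good nu ->
    \sum_eta nu eta * (untypical p (delta * n%:R) (nparticles rho n) eta)%:R <= eps.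
Proof.
move=> delta02 eps0; have /andP[p0 p1] := p01.
have h1 := prho; have h2 := rho2; have h3 := rho0.
pose tau := rho - p * (1 - rho).
have tau0 : 0 < tau by rewrite subr_gt0.
have tau1 : tau < 1 by rewrite /tau; nra.
(* [p'] lies strictly between [p] and the limiting density [rho / (1 - rho)] of particles per box,
   which leaves room for a positive drift. *)
pose p' := p + tau / 2.
have pp' : p < p' by rewrite ltrDl divr_gt0.
have p'rho : p' * (1 - rho) < rho by rewrite /p' /tau; nra.
have p'1 : p' < 1 by nra.
have [theta th0 Hth] : exists2 theta : R, 0 < theta &
    p * expR theta + (1 - p) <= expR (theta * p').
  by apply: bernoulli_drift => //; rewrite pp'.
pose c0 := lambda * (1 - p) * (1 - expR (- (theta * p'))).
have c0_gt0 : 0 < c0.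
  rewrite !mulr_gt0 ?subr_gt0 // -expR0 ltr_expR oppr_lt0 mulr_gt0 //; lra.
(* If the cluster is a pair, the boxes hold about [tau * n] more particles than [p * L], so the
   state is atypical at level [tau / 2]. *)
pose delta0 := tau / 2.
pose gam := (1 + p') * rho - p'.
have gam0 : 0 < gam by rewrite /gam; lra.
pose K0 := (6 / (delta0 ^+ 2 / 8)) ^+ 6; pose K := (6 / (delta ^+ 2 / 8)) ^+ 6.
near=> n => nu [nu0 nu1 nug nus].
have X1 : 1 <= n%:R :> R by near: n; exact: nbhs_infty_ger.
have Xl : lambda <= n%:R :> R by near: n; exact: nbhs_infty_ger.
have Xg : 1 / gam <= n%:R :> R by near: n; exact: nbhs_infty_ger.
have Xt : 5 / tau <= n%:R :> R by near: n; exact: nbhs_infty_ger.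
have Xe : (2 / c0 * K0 + 2 * K) / eps <= n%:R :> R by near: n; exact: nbhs_infty_ger.
have /andP[m1 m2] := nparticles_bounds n (ltW rho0).
have [m2' L0 Hn] : let m := nparticles rho n in
  [/\ (1 < m)%N, (0 < (n - m).-1)%N & n = (m + (n - m).-1).+1].
  by near: n; exact: near_dims.
set m := nparticles rho n in m1 m2 m2' L0 Hn nug *.
set L := (n - m).-1 in L0 Hn nug *.
set X := n%:R : R in m1 m2 X1 Xl Xg Xt Xe *.
rewrite ler_pdivrMr // in Xg; rewrite ler_pdivrMr // in Xt; rewrite ler_pdivrMr // in Xe.
have X0 : 0 < X by lra.
have LX : L%:R = X - m%:R - 1 :> R.
  by rewrite /X Hn -natr1 natrD; ring.
have L1X : L.+1%:R = X - m%:R :> R by rewrite -natr1 LX; ring.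
have L1X' : L.+1%:R <= X by rewrite L1X lerBlDr lerDl.
have p'm : p' * L%:R <= m%:R - 1 by rewrite LX; rewrite /gam in Xg; nra.
have p'a : p' <= m%:R / L.+1%:R by rewrite ler_pdivlMr ?ltr0Sn // L1X; nra.
have lamX : 0 <= lambda <= n%:R by rewrite (ltW lambda0) Xl.
pose g (eta : config n) : R := (untypical p (delta * X) m eta)%:R.
have ug : unit_on_good m L g.
  by move=> e _; rewrite /g; case: (untypical _ _ _ _); rewrite ?lexx ler01.
pose phi D bs : R := (atypical p L (D * X) bs)%:R.
have gphi l bs : size bs = L -> (1 < m - count id bs)%N -> g (st m l bs) <= phi delta bs.
  move=> sbs c2; rewrite /g /phi ler_nat.
  have [|na] := boolP (atypical p L (delta * X) bs); first by rewrite leq_b1.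
  rewrite (_ : untypical _ _ _ _ = false) //; apply/negbTE; rewrite negbK.
  apply/existsP; exists l; apply/existsP; exists (Tuple (introT eqP sbs)).
  by rewrite c2 na eqxx.
have phi01 bs : size bs = L -> (count id bs + 2)%N = m -> 1 <= phi delta0 bs.
  move=> sbs cbs; rewrite /phi (_ : atypical _ _ _ _) //.
  apply/existsP; exists ord_max; rewrite /= -{1}sbs take_size.
  have cm : (count id bs)%:R + 2 = m%:R :> R by rewrite -cbs natrD.
  rewrite lter_normr; apply/orP; left; rewrite LX /delta0; rewrite /tau in Xt *; nra.
have q0 : 0 < c0 / n%:R ^+ 3 by rewrite divr_gt0 ?exprn_gt0.
have := stationary_bound Hn L0 p01 lamX nu0 nug nus ug (phi := phi delta)
  (phi0 := phi delta0) (fun _ => ler0n _ _) (fun _ => ler0n _ _) gphi phi01 q0.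
case.
  by move=> e ge ie; exact: (perturb_ge Hn L0 p01 lamX).
have meanC c : mean nu (fun=> c) = c by rewrite /mean -mulr_suml nu1 mul1r.
rewrite !meanC => y0 [H1 H2].
have [d0 d0'] : 0 < delta0 <= 2 /\ 0 < delta0 by rewrite /delta0; split; lra.
have B0 := atypical_bound p01 d0 L1X'; have B := atypical_bound p01 delta02 L1X'.
have d8 : 0 < delta ^+ 2 / 8 by case/andP: delta02 => d1 _; rewrite divr_gt0 ?exprn_gt0.
have d80 : 0 < delta0 ^+ 2 / 8 by rewrite divr_gt0 ?exprn_gt0.
have := exp_decay d80 (ltW X0); have := exp_decay d8 (ltW X0).
rewrite -/K -/K0 => E E0.
have {H2}H2 := le_trans H2 B0; have {H1}H1 := le_trans H1 (lerD (lexx _) B).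
rewrite mulrAC ler_pdivrMr ?exprn_gt0 // -/X in H2.
set e0 := expR _ in H2 E0; set e1 := expR _ in H1 E.
have e1_ge0 : 0 <= e1 by exact: expR_ge0.
rewrite -(ler_pM2l X0); apply: le_trans Xe.
have Ly : L%:R * ideal_rate p nu <= X * ideal_rate p nu.
  by rewrite ler_wpM2r // LX; lra.
apply: le_trans (ler_wpM2l (ltW X0) (le_trans H1 (lerD Ly (lexx _)))) _.
rewrite mulrDr; apply: lerD.
  rewrite mulrAC ler_pdivlMr //.
  have := ler_wpM2l (ltW (mulr_gt0 X0 X0)) H2.
  have -> : X * X * (2 * X * e0 * X ^+ 3) = 2 * (X ^+ 6 * e0) by ring.
  lra.
have : X ^+ 2 * e1 <= X ^+ 6 * e1 by rewrite ler_wpM2r // ler_weXn2l.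
lra.
Unshelve. all: end_near. Qed.

End Concentration.

(** * Flux *)

Section Invariance.
Variables (R : realType) (n m L : nat) (p lambda : R).
Hypothesis Hn : n = (m + L).+1.
Hypothesis L0 : (0 < L)%N.
Hypothesis p01 : 0 < p < 1.

Lemma good_trans (eta eta' : config n) : good m L eta ->
  0 < trans_prob p lambda eta eta' -> good m L eta'.
Proof.
move=> ge; apply: contraPP => nge; apply/negP; rewrite -leNgt.
rewrite /trans_prob step_meanE -[leRHS](move_cst Hn L0 p01 0 ge).
have neq e : good m L e -> (e == eta')%:R = 0 :> R.
  by move=> ge'; case: eqP => // E; case: nge; rewrite -E.
apply: (le_move Hn L0 p01) => // e ge'; rewrite /perturb neq // mulr0 add0r.
rewrite /pert_prob; case: ifP => ie; last by rewrite mul0r.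
rewrite /relocation_mean big1 ?mul0r ?mulr0 // => a ae.
rewrite big1 ?mul0r // => b; rewrite inE => be.
by apply: neq; apply: (good_perturb Hn).
Qed.

Lemma good_connect (T : finType) (K : T -> T -> R) (f : T -> config n) z0 z :
  (forall u v, 0 < K u v -> 0 < trans_prob p lambda (f u) (f v)) ->
  good m L (f z0) -> connect [rel u v | 0 < K u v] z0 z -> good m L (f z).
Proof.
move=> HK g0 /connectP[s ps ->]; elim: s z0 g0 ps => //= v s IH z0 g0 /andP[h ps].
by apply: IH ps; apply: good_trans g0 _; exact: HK.
Qed.

End Invariance.

Section Marginal.
Variables (R : realType) (p lambda rho : R).
Hypothesis p01 : 0 < p < 1.
Hypothesis prho : p * (1 - rho) < rho.
Hypothesis rho2 : rho < 1 / 2.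

Lemma tasep_stationary_good : \forall n \near \oo, forall nu : config n -> R,
  tasep_stationary p lambda rho nu -> stationary_good p rho lambda nu.
Proof.
apply: filterS (near_dims p01 prho rho2) => n [m2 L0 Hn] nu [nu0 nu1 nug nus].
split=> // eta /nug[z0 /(good_one_cluster Hn) g0].
by move=> cn; exact: (good_connect Hn L0 p01 (f := id) (fun _ _ h => h) g0 cn).
Qed.

(** The new site is determined by the new configuration and the old site, so summing it out leaves
    [trans_prob]. *)
Lemma tasep_stationary_ext_good : \forall n \near \oo, forall pi : config n * 'I_n -> R,
  tasep_stationary_ext p lambda rho pi ->
  stationary_good p rho lambda (fun eta => \sum_s pi (eta, s)).
Proof.
apply: filterS (near_dims p01 prho rho2) => n [m2 L0 Hn] pi [pi0 pi1 pig pis].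
split.
- by move=> eta; rewrite sumr_ge0.
- by rewrite pair_big -[RHS]pi1; apply: eq_bigr => -[].
- move=> eta; rewrite psumr_eq0 //; move=> /allPn[s _ /= /pig[z0 /andP[/(good_one_cluster Hn)
  g0 _]]].
  apply: (good_connect Hn L0 p01 (lambda := lambda) (f := fst) (K := trans_prob_ext p lambda)
    _ g0) => u v; rewrite /trans_prob_ext.
  by case: (_ == _); rewrite ?mulr1 // mulr0 ltxx.
move=> eta'.
transitivity (\sum_z pi z * trans_prob p lambda z.1 eta').
  under eq_bigr do rewrite mulr_suml.
  by rewrite pair_big; apply: eq_bigr => -[].
under [RHS]eq_bigr do rewrite -pis.
rewrite exchange_big /=; apply: eq_bigr => z _.
rewrite -mulr_sumr; congr (_ * _); rewrite /trans_prob_ext /= -mulr_sumr.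
rewrite (bigD1 (left_site eta' z.2)) //= eqxx big1 ?addr0 ?mulr1 // => s /negPf ->.
by [].
Qed.

End Marginal.

Section Flux.
Variables (R : realType).

Lemma average_bounds (I : finType) (A : {set I}) (f : I -> R) x y :
  (0 < #|A|)%N -> (forall i, i \in A -> x <= f i <= y) ->
  x <= (\sum_(i in A) f i) / #|A|%:R <= y.
Proof.
move=> A0 H; rewrite ler_pdivlMr ?ltr0n // ler_pdivrMr ?ltr0n // !mulr_natr -!sumr_const.
by apply/andP; split; apply: ler_sum => i /H /andP[].
Qed.

Variables (n m L : nat) (p lambda : R).
Hypothesis Hn : n = (m + L).+1.
Hypothesis L0 : (0 < L)%N.
Hypothesis p01 : 0 < p < 1.
Hypothesis lambda_n : 0 <= lambda <= n%:R.

Let inner (e : config n) (d : nat) : R :=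
  (1 - pert_prob lambda e) * d%:R + pert_prob lambda e *
  ((\sum_(a in e) (\sum_(b in ~: (e :\ a)) (d + cw_dist a b)%:R) / #|~: (e :\ a)|%:R)
     / #|e|%:R).

(** A perturbation has probability at most [lambda / n] and carries its particle less than [n]
    sites, so it adds at most [lambda] to the mean. *)
Let inner_bounds e d : good m L e -> d%:R <= inner e d <= d%:R + lambda.
Proof.
move=> ge.
have ce : #|e| = m.
  by case: ge => l [bs [sbs cbs ->]]; exact: (card_st Hn).
have m0 := good_gt0 ge.
rewrite /inner; set A := (\sum_(a in e) _) / _.
have /andP[A1 A2] : d%:R <= A <= d%:R + n%:R.
  apply: average_bounds => [|a ae]; first by rewrite ce.
  apply: average_bounds => [|b be].
    have := cardsC (e :\ a); rewrite card_ord; have := cardsD1 a e; rewrite ae ce; lia.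
  by rewrite natrD lerDl ler0n lerD2l ler_nat ltnW // cw_dist_lt.
have n0 : 0 < n%:R :> R by rewrite Hn.
have [q0 q1] : 0 <= pert_prob lambda e /\ pert_prob lambda e * n%:R <= lambda.
  case/andP: lambda_n => l0 l1.
  rewrite /pert_prob; case: ifP; last by rewrite mul0r lexx.
  by rewrite divfK ?lt0r_neq0 // lexx divr_ge0 ?ler0n.
have h1 : pert_prob lambda e * d%:R <= pert_prob lambda e * A by rewrite ler_wpM2l.
have h2 : pert_prob lambda e * A <= pert_prob lambda e * (d%:R + n%:R) by rewrite ler_wpM2l.
by apply/andP; split; lra.
Qed.

Let mean_distanceE eta : mean_distance p lambda eta =
  \sum_M movers_prob p eta M * inner (moved eta M) #|M|.
Proof. by []. Qed.

(** All free particles move, and at most one particle of the cluster does. *)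
Lemma mean_distance_st (l : 'I_n) bs : size bs = L -> (1 < m - count id bs)%N ->
  (count id bs)%:R <= mean_distance p lambda (st m l bs) <= (count id bs)%:R + 1 + lambda.
Proof.
case/lastP: bs => [|bs x] sbs c2; first by move: L0; rewrite -sbs.
rewrite mean_distanceE.
rewrite (sum_movers_st Hn) //; last by lia.
have sbs1 : (size bs).+1 = L by rewrite -sbs size_rcons.
rewrite (moved_st_rcons l true Hn sbs1 c2) (moved_st_rcons l false Hn sbs1 c2).
rewrite !(card_movers Hn) //; try lia.
have /andP[p0 p1] := p01.
have /andP[] := inner_bounds (count id (rcons bs x) + true)
  (good_st_cons (if x then ord_pred l else l) true sbs c2).
have /andP[] := inner_bounds (count id (rcons bs x) + false)
  (good_st_cons (if x then ord_pred l else l) false sbs c2).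
rewrite !natrD mulr0n mulr1n; move: (inner _ _) (inner _ _) => i0 i1.
nra.
Qed.

Lemma mean_distance_good (eta : config n) : good m L eta ->
  0 <= mean_distance p lambda eta <= n%:R + 1 + lambda.
Proof.
have /andP[l0 l1] := lambda_n.
move=> /(goodP L0) [[l [bs [sbs cbs ->]]]|[l [bs [x [sbs c2 ->]]]]].
  have iso : isolated (st m l bs) by exact: (st_isolated Hn).
  rewrite mean_distanceE.
  rewrite (@sum_movers_det _ _ _ _ (st m l bs)); last by move=> i; exact: jump_isolated.
  rewrite (moved_isolated _ sbs cbs) (card_st Hn) //; last by lia.
  have /andP[] := inner_bounds m (good_st_ordS l sbs cbs).
  have : m%:R <= n%:R :> R by rewrite ler_nat Hn; lia.
  have : 0 <= m%:R :> R by [].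
  move: (inner _ _) => i0; lra.
have /andP[] := mean_distance_st l sbs c2.
have : (count id (rcons bs x))%:R <= n%:R :> R by rewrite ler_nat Hn; lia.
have : 0 <= (count id (rcons bs x))%:R :> R by [].
lra.
Qed.

End Flux.

Section FluxLimit.
Variables (R : realType) (p lambda rho : R).
Hypothesis p01 : 0 < p < 1.
Hypothesis lambda0 : 0 < lambda.
Hypothesis prho : p * (1 - rho) < rho.
Hypothesis rho2 : rho < 1 / 2.

Lemma typical_count (n m : nat) (D : R) (bs : bitseq) :
  n = (m + (n - m).-1).+1 -> rho * n%:R <= m%:R <= rho * n%:R + 1 ->
  size bs = (n - m).-1 ->
  ~~ atypical p (n - m).-1 D bs -> `|(count id bs)%:R - p * (1 - rho) * n%:R| <= D + 2.
Proof.
move=> Hn /andP[m1 m2] sbs; rewrite /atypical negb_exists => /forallP/(_ ord_max) /=.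
have /andP[p0 p1] := p01.
rewrite -leNgt -{1}sbs take_size.
have nE : n%:R = m%:R + ((n - m).-1)%:R + 1 :> R by rewrite {1}Hn -natr1 natrD.
rewrite !ler_norml => /andP[h1 h2]; apply/andP; split; nra.
Qed.

Lemma flux_limit (nu : forall n, config n -> R) :
  (\forall n \near \oo, tasep_stationary p lambda rho (nu n)) ->
  flux p lambda (nu n) @[n --> \oo] --> p * (1 - rho).
Proof.
move=> H; apply/cvgrPdist_le => eps eps0.
have /andP[p0 p1] := p01.
have rho0 : 0 < rho by rewrite ltNge; apply/negP => r0; have := prho; nra.
pose delta := Num.min 2 (eps / 3).
have delta02 : 0 < delta <= 2 by rewrite /delta lt_min ge_min lexx ltr0n divr_gt0.
have delta_eps : delta <= eps / 3 by rewrite ge_min lexx orbT.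
(* Crude bound on the error at untypical states: [p * (1 - rho) <= 1], and the distance per site is
   at most [2 + lambda]. *)
pose C := 3 + lambda.
have C0 : 0 < C by rewrite /C; have := lambda0; lra.
have C1 : 0 < eps / 3 / C by rewrite !divr_gt0.
have sg : \forall n \near \oo, stationary_good p rho lambda (nu n).
  by apply: filterS2 H (tasep_stationary_good lambda p01 prho rho2) => n h1; apply.
have conc : \forall n \near \oo, \sum_eta nu n eta *
    (untypical p (delta * n%:R) (nparticles rho n) eta)%:R <= eps / 3 / C.
  by apply: filterS2 sg (concentration p01 prho rho2 lambda0 delta02 C1) => n h1; apply.
near=> n.
have [m2 L0 Hn] : let m := nparticles rho n in
  [/\ (1 < m)%N, (0 < (n - m).-1)%N & n = (m + (n - m).-1).+1].
  by near: n; exact: (near_dims p01 prho rho2).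
have [nu0 nu1 nug nus] : stationary_good p rho lambda (nu n) by near: n.
have cn : \sum_eta nu n eta *
    (untypical p (delta * n%:R) (nparticles rho n) eta)%:R <= eps / 3 / C by near: n.
have X1 : 1 <= n%:R :> R by near: n; exact: nbhs_infty_ger.
have Xl : lambda <= n%:R :> R by near: n; exact: nbhs_infty_ger.
have XC : C / (eps / 3) <= n%:R :> R by near: n; exact: nbhs_infty_ger.
rewrite ler_pdivrMr ?divr_gt0 // in XC.
have lam_n : 0 <= lambda <= n%:R by rewrite ltW.
have X0 : 0 < n%:R :> R by lra.
have mb := nparticles_bounds n (ltW rho0).
set m := nparticles rho n in m2 L0 Hn nug cn mb.
have mb' : rho * n%:R <= m%:R <= rho * n%:R + 1.
  by case/andP: mb => -> /ltW.
have pt (eta : config n) : good m (n - m).-1 eta ->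
    `|p * (1 - rho) - mean_distance p lambda eta / n%:R| <=
    2 * (eps / 3) + C * (untypical p (delta * n%:R) m eta)%:R.
  move=> ge.
  have -> : p * (1 - rho) - mean_distance p lambda eta / n%:R =
      (p * (1 - rho) * n%:R - mean_distance p lambda eta) / n%:R.
    by rewrite mulrBl mulfK ?lt0r_neq0.
  rewrite normrM [`|_^-1|]gtr0_norm ?invr_gt0 //.
  rewrite ler_pdivrMr //.
  have h2 := rho2; have h3 := lambda0.
  have [_|] := boolP (untypical _ _ _ _).
    have /andP[h4 h5] := mean_distance_good Hn L0 p01 lam_n ge.
    have h6 : 0 <= p * (1 - rho) * n%:R <= n%:R.
      rewrite mulr_ge0 ?mulr_ge0 ?(ltW p0) //=; last by lra.
      by rewrite ler_piMl //; nra.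
    have h7 : 0 <= eps / 3 * n%:R by rewrite mulr_ge0 ?divr_ge0 // ltW.
    have h8 : lambda <= lambda * n%:R by rewrite ler_peMr // ltW.
    case/andP: h6 => h6 h6'.
    rewrite mulr1 /C ler_norml; apply/andP; split; lra.
  rewrite negbK mulr0 addr0 => /existsP[l /existsP[bs /and3P[c2 ty /eqP ->]]].
  have /andP[h4 h5] := mean_distance_st Hn L0 p01 lam_n l (size_tuple bs) c2.
  have := typical_count Hn mb' (size_tuple bs) ty.
  have h7 : delta * n%:R <= eps / 3 * n%:R by rewrite ler_wpM2r.
  rewrite /C in XC.
  by rewrite !ler_norml => /andP[h8 h9]; apply/andP; split; lra.
have -> : p * (1 - rho) - flux p lambda (nu n) =
    \sum_eta nu n eta * (p * (1 - rho) - mean_distance p lambda eta / n%:R).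
  rewrite /flux; under [RHS]eq_bigr do rewrite mulrBr.
  by rewrite sumrB -mulr_suml nu1 mul1r.
apply: le_trans (ler_norm_sum _ _ _) _.
apply: le_trans (_ : _ <= \sum_eta nu n eta *
   (2 * (eps / 3) + C * (untypical p (delta * n%:R) m eta)%:R)) _.
  apply: ler_sum => eta _; rewrite normrM ger0_norm //.
  have [->|/nug ge] := eqVneq (nu n eta) 0; first by rewrite !mul0r.
  by rewrite ler_wpM2l // pt.
under eq_bigr do rewrite mulrDr [X in _ + X]mulrCA.
rewrite big_split /= -mulr_suml nu1 mul1r -mulr_sumr.
have := ler_wpM2l (ltW C0) cn; rewrite [C * (_ / C)]mulrC divfK ?lt0r_neq0 //; lra.
Unshelve. all: end_near. Qed.

End FluxLimit.

(** * Main equilibrium states *)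

Section Equilibrium.
Variables (R : realType) (h rho : R).
Hypothesis h01 : 0 < h < 1.
Hypothesis hrho : h < rho < 1.

Local Notation T := (tau_star h rho).

Lemma tau_star01 : 0 < T < 1.
Proof.
have /andP[h0 h1] := h01; have /andP[h2 h3] := hrho.
have h4 : 0 < 1 - h by lra.
by rewrite /tau_star divr_gt0 ?subr_gt0 // ltr_pdivrMr // mul1r; lra.
Qed.

Lemma tau_starE : (1 - h) * T = rho - h.
Proof. by have /andP[h0 h1] := h01; rewrite /tau_star mulrC divfK // subr_eq0 gt_eqF. Qed.

(* Length of the part of [0, x] covered by the clusters [k, k + tau_star]. *)
Definition covered (x : R) : R :=
  (Num.floor x)%:~R * T + Num.min (x - (Num.floor x)%:~R) T.

Definition mes_profile (x : R) : R := h * x + (1 - h) * covered x.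

Lemma coveredD1 x : covered (x + 1) = covered x + T.
Proof.
rewrite /covered (_ : x + 1 = x + 1%:~R) // floorDrz ?intr_int // intrKfloor intrD.
by rewrite mulrDl mul1r opprD addrACA subrr addr0 addrAC.
Qed.

Lemma mes_profileD1 x : mes_profile (x + 1) = mes_profile x + rho.
Proof. by rewrite /mes_profile coveredD1; have := tau_starE; lra. Qed.

Lemma mes_profileDz (k : int) x : mes_profile (x + k%:~R) = mes_profile x + k%:~R * rho.
Proof.
have Hn (m : nat) y : mes_profile (y + m%:R) = mes_profile y + m%:R * rho.
  elim: m => [|m IH]; first by rewrite addr0 mul0r addr0.
  by rewrite -natr1 addrA mes_profileD1 IH mulrDl mul1r addrA.
case: k => m; first exact: Hn.
by rewrite NegzE mulrNz -pmulrn mulNr -[in RHS](subrK m.+1%:R x) Hn addrK.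
Qed.

Lemma covered_unit x : 0 <= x <= 1 -> covered x = Num.min x T.
Proof.
have /andP[T0 T1] := tau_star01.
case/andP => x0; rewrite le_eqVlt => /orP[/eqP ->|x1]; rewrite /covered.
  by rewrite floor1 mul1r subrr !minEle ltW // leNgt T1 /= addr0.
have -> : Num.floor x = 0 by apply/eqP; rewrite floor_eq x0.
by rewrite mul0r add0r subr0.
Qed.

Lemma covered_mono x y : x <= y -> 0 <= covered y - covered x <= y - x.
Proof.
have /andP[T0 T1] := tau_star01.
move=> xy; rewrite /covered.
have /andP[fx1 fx2] := floor_itv x; have /andP[fy1 fy2] := floor_itv y.
have fxy : (Num.floor x <= Num.floor y)%R by rewrite floor_ge_int (le_trans fx1).
rewrite intrD in fx2 fy2.
move: fxy; rewrite le_eqVlt => /orP[/eqP E|].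
  rewrite -E in fy1 fy2 *; move: ((Num.floor x)%:~R : R) fx1 fx2 fy1 fy2 => k *.
  by rewrite !minEle; do 2! case: ifPn; rewrite -?ltNge => *; apply/andP; split; lra.
rewrite -lezD1 -(ler_int R) intrD.
move: ((Num.floor x)%:~R : R) ((Num.floor y)%:~R : R) fx1 fx2 fy1 fy2 => k j ? ? ? ? kj.
have h1 : 0 <= (j - k - 1) * T by rewrite mulr_ge0 //; lra.
have h2 : 0 <= (j - k - 1) * (1 - T) by rewrite mulr_ge0 //; lra.
by rewrite !minEle; do 2! case: ifPn; rewrite -?ltNge => *; apply/andP; split; lra.
Qed.

Lemma mes_profile_lip x y : `|mes_profile x - mes_profile y| <= `|x - y|.
Proof.
have /andP[h0 h1] := h01.
wlog xy : x y / y <= x.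
  move=> H; have [yx|/ltW xy] := leP y x; first exact: H.
  by rewrite distrC [leRHS]distrC; exact: H.
have /andP[c1 c2] := covered_mono xy.
rewrite [leRHS]ger0_norm ?subr_ge0 // ger0_norm /mes_profile; last first.
  have : 0 <= h * (x - y) by rewrite mulr_ge0 ?subr_ge0 // ltW.
  have : 0 <= (1 - h) * (covered x - covered y) by apply: mulr_ge0 => //; lra.
  lra.
have : (1 - h) * (covered x - covered y) <= (1 - h) * (x - y).
  by rewrite ler_wpM2l // subr_ge0 ltW.
lra.
Qed.

Definition mes_f (l x : R) : R := mes_profile (x - l) - mes_profile (- l).

(** Both terms of [mes_f] are 1-Lipschitz in the cluster location, and whole turns add the same
    multiple of [rho] to both. *)
Lemma mes_f_dist (l1 l2 x : R) (k : int) :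
  `|mes_f l1 x - mes_f l2 x| <= 2 * `|l1 - l2 + k%:~R|.
Proof.
have e1 : mes_profile (x - l2 + k%:~R) = mes_profile (x - l2) + k%:~R * rho by exact:
  mes_profileDz.
have e2 : mes_profile (- l2 + k%:~R) = mes_profile (- l2) + k%:~R * rho by exact: mes_profileDz.
have -> : mes_f l1 x - mes_f l2 x = (mes_profile (x - l1) - mes_profile (x - l2 + k%:~R)) -
    (mes_profile (- l1) - mes_profile (- l2 + k%:~R)).
  by rewrite e1 e2 /mes_f; lra.
apply: le_trans (ler_normB _ _) _.
have := mes_profile_lip (x - l1) (x - l2 + k%:~R).
have := mes_profile_lip (- l1) (- l2 + k%:~R).
have -> : x - l1 - (x - l2 + k%:~R) = - (l1 - l2 + k%:~R) by ring.
have -> : - l1 - (- l2 + k%:~R) = - (l1 - l2 + k%:~R) by ring.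
rewrite normrN; lra.
Qed.

Section MES.
Variable z : sstate rho.
Let l := ss_l z.

Lemma mes_f0 : mes_f l 0 = 0. Proof. by rewrite /mes_f sub0r subrr. Qed.

Lemma mes_fD1 x : mes_f l (x + 1) = mes_f l x + rho.
Proof. by rewrite /mes_f [x + 1 - l]addrAC mes_profileD1 addrAC. Qed.

Lemma mes_f_bnd : exists C : R, forall x, 0 <= x < 1 -> `|mes_f l x| <= C.
Proof.
exists 1 => x /andP[x0 x1]; apply: le_trans (mes_profile_lip _ _) _.
by rewrite opprK subrK ger0_norm // ltW.
Qed.

Lemma mes_lr : l <= l + T.
Proof. by have /andP[T0 _] := tau_star01; rewrite lerDl ltW. Qed.

Lemma mes_tauE : T = l + T - l. Proof. by rewrite addrAC subrr add0r. Qed.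

Definition mes : sstate rho :=
  @SState R rho (mes_f l) l (l + T) T mes_f0 mes_fD1 mes_f_bnd (ss_l01 z) mes_lr mes_tauE.

End MES.

Lemma circle_distD (a b c : R) : circle_dist (a + c) (b + c) = circle_dist a b.
Proof.
by rewrite /circle_dist; congr inf; apply/seteqP; split=> _ [k _ <-]; exists k => //;
  rewrite opprD addrACA subrr addr0.
Qed.

Lemma ss_dist_mes z1 z2 : ss_dist (mes z1) (mes z2) <= 4 * circle_dist (ss_l z1) (ss_l z2).
Proof.
rewrite /ss_dist /= subrr normr0 addr0 circle_distD.
suff : sup_dist (mes_f (ss_l z1)) (mes_f (ss_l z2)) <= 2 * circle_dist (ss_l z1) (ss_l z2) by
  lra.
apply: ge_sup; first by case: (sup_dist_has (mes z1) (mes z2)).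
move=> _ [x _ <-]; rewrite -ler_pdivrMl //.
apply: lb_le_inf; first by case: (circle_dist_has (ss_l z1) (ss_l z2)).
by move=> _ [k _ <-]; rewrite ler_pdivrMl //; exact: mes_f_dist.
Qed.

Lemma ss_dist_mes_lip z1 z2 :
  ss_dist z1 (mes z1) <= ss_dist z2 (mes z2) + 5 * ss_dist z1 z2.
Proof.
have h1 := ss_dist_triangle z2 z1 (mes z1).
have h2 := ss_dist_triangle (mes z2) z2 (mes z1).
have h3 := ss_dist_mes z2 z1.
have h4 : circle_dist (ss_l z2) (ss_l z1) <= ss_dist z2 z1.
  rewrite /ss_dist; have := sup_dist_ge0 z2 z1; have := normr_ge0 (ss_tau z2 - ss_tau z1).
  by have := circle_dist_ge0 (ss_r z2) (ss_r z1); lra.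
have h5 := ss_dist_sym z2 z1.
lra.
Qed.

Lemma mes_f_unit l x : l <= x <= l + 1 ->
  mes_f l x = h * (x - l) + (1 - h) * Num.min (x - l) T - mes_profile (- l).
Proof.
by move=> /andP[lx xl]; rewrite /mes_f /mes_profile covered_unit // subr_ge0 lx lerBlDl.
Qed.

End Equilibrium.

Lemma is_derive_cst_diff (R : realType) (f : R -> R) (c a b : R) : a <= b ->
  (forall x, a < x < b -> is_derive x (1 : R) f c) -> continuous f ->
  f b - f a = c * (b - a).
Proof.
move=> ab df cf.
have df' x : x \in `]a, b[ -> is_derive x 1 f c by rewrite in_itv /= => /df.
by have [x _ ->] := MVT_segment ab df' (continuous_subspaceT cf).
Qed.

Lemma is_derive_affine (R : realType) (f : R -> R) (c d x e : R) : 0 < e ->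
  (forall y, `|x - y| < e -> f y = c * y + d) -> is_derive x (1 : R) f c.
Proof.
move=> e0 H.
apply: (@near_eq_is_derive _ _ _ (fun y => c * y + d)).
  by apply/nbhs_ballP; exists e => //= y; rewrite /ball /= => /H.
apply: is_derive_eq; rewrite addr0 /GRing.scale /= mulr1 //.
Qed.

Section MESChar.
Variables (R : realType) (h rho : R).
Hypothesis h01 : 0 < h < 1.
Hypothesis hrho : h < rho < 1.
Local Notation T := (tau_star h rho).
Local Notation mes := (@mes R h rho h01 hrho).

Lemma mes_f_continuous l : continuous (mes_f h rho l).
Proof.
move=> x; apply/cvgrPdist_lt => e e0; apply/nbhs_ballP; exists e => //= y.
rewrite /ball /= => xy; rewrite /mes_f opprB addrA subrK.
apply: le_lt_trans (mes_profile_lip h01 hrho _ _) _.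
by rewrite opprB addrA subrK.
Qed.

(** The mean value theorem integrates the two constant slopes over one period starting at the left
    end of the cluster, and [ss_f z 0 = 0] fixes the constant. Conversely [mes_f] is affine near
    every point other than the corners. *)
Lemma main_equilibriumE (z : sstate rho) : main_equilibrium h rho z <-> z = mes z.
Proof.
have /andP[T0 T1] := tau_star01 h01 hrho.
have tE := tau_starE rho h01.
split=> [[tz rz cf d1 d2]|E].
  apply: sstate_eq => //.
  have f1 y : ss_l z <= y <= ss_r z -> ss_f z y = ss_f z (ss_l z) + (y - ss_l z).
    move=> /andP[ly yr]; apply/eqP; rewrite addrC -subr_eq; apply/eqP.
    rewrite -[RHS]mul1r; apply: is_derive_cst_diff => // x /andP[lx xy].
    by apply: d1; rewrite lx (lt_le_trans xy).
  have f2 y : ss_r z <= y <= ss_l z + 1 -> ss_f z y = ss_f z (ss_r z) + h * (y - ss_r z).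
    move=> /andP[ly yr]; apply/eqP; rewrite addrC -subr_eq; apply/eqP.
    apply: is_derive_cst_diff => // x /andP[lx xy].
    by apply: d2; rewrite lx (lt_le_trans xy).
  have f3 y : ss_l z <= y <= ss_l z + 1 ->
      ss_f z y = ss_f z (ss_l z) + (mes_f h rho (ss_l z) y + mes_profile h rho (- ss_l z)).
    move=> /andP[ly yl]; rewrite mes_f_unit ?ly // subrK.
    have rE : ss_r z = ss_l z + T by rewrite rz tz.
    have [yT|yT] := leP y (ss_r z).
      by rewrite f1 ?ly // minEle ifT ?mulrBl ?mul1r; [ring|lra].
    rewrite f2 ?(ltW yT) // f1 ?rE ?minEle ?ifF; first by lra.
      by apply/negbTE; rewrite -ltNge; lra.
    by rewrite lerDl ltW //=.
  have f4 x : ss_f z x = ss_f z (ss_l z) + (mes_f h rho (ss_l z) x + mes_profile h rho (-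
    ss_l z)).
    have /andP[k1 k2] := floor_itv (x - ss_l z); rewrite intrD in k2.
    set k := Num.floor (x - ss_l z) in k1 k2.
    have xE : x = (x - k%:~R) + k%:~R by rewrite subrK.
    rewrite xE ss_fDz f3; last by apply/andP; split; lra.
    have := ss_fDz (mes z) k (x - k%:~R); rewrite /= => ->; ring.
  have := f4 0; rewrite ss_f0 [mes_f _ _ _ 0]/mes_f sub0r subrr add0r => H.
  by apply/funext => x; rewrite f4 /=; lra.
have cf := @mes_f_continuous (ss_l z).
have et : ss_tau z = T := congr1 (@ss_tau _ _) E.
have er : ss_r z = ss_l z + T := congr1 (@ss_r _ _) E.
have ef : ss_f z = mes_f h rho (ss_l z) := congr1 (@ss_f _ _) E.
split; [exact: et | by rewrite er et | by rewrite ef | | ]; move=> x;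
  rewrite er ef => /andP[x1 x2].
- apply: (@is_derive_affine _ _ _ (- ss_l z - mes_profile h rho (- ss_l z)) _
    (Num.min (x - ss_l z) (ss_l z + T - x))).
    by rewrite lt_min; apply/andP; split; lra.
  move=> y; rewrite lt_min !ltr_norml => /andP[/andP[? ?] /andP[? ?]].
  rewrite (mes_f_unit h01 hrho); last by apply/andP; split; lra.
  by rewrite minEle ifT; lra.
- apply: (@is_derive_affine _ _ _ (- h * ss_l z + (1 - h) * T - mes_profile h rho (- ss_l z)) _
    (Num.min (x - (ss_l z + T)) (ss_l z + 1 - x))).
    by rewrite lt_min; apply/andP; split; lra.
  move=> y; rewrite lt_min !ltr_norml => /andP[/andP[? ?] /andP[? ?]].
  rewrite (mes_f_unit h01 hrho); last by apply/andP; split; lra.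
  rewrite minEle ifF; first by lra.
  by apply/negbTE; rewrite -ltNge; lra.
Qed.

Definition mes_gap (z : sstate rho) : R := Num.min 1 (ss_dist z (mes z)).

Lemma ss_dist_ge0 (z1 z2 : sstate rho) : 0 <= ss_dist z1 z2.
Proof. by rewrite /ss_dist !addr_ge0 ?sup_dist_ge0 ?circle_dist_ge0. Qed.

Lemma mes_gap_ge0 z : 0 <= mes_gap z.
Proof. by rewrite le_min ler01 ss_dist_ge0. Qed.

Lemma mes_gap_le1 z : mes_gap z <= 1.
Proof. by rewrite ge_min lexx. Qed.

Lemma mes_gap_eq0 z : mes_gap z = 0 <-> main_equilibrium h rho z.
Proof.
rewrite main_equilibriumE; split=> [|E].
  rewrite /mes_gap minEle; case: ifP => _; first by move/eqP; rewrite oner_eq0.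
  exact: ss_dist_positivity.
by rewrite /mes_gap -E ss_distxx minEle ifF // leNgt ltr01.
Qed.

Lemma mes_gap_continuous : continuous mes_gap.
Proof.
move=> z A /nbhs_ballP[e e0 HA]; apply/nbhs_ballP.
exists (e / 5); first by rewrite /= divr_gt0.
move=> z' zz'; apply: HA; rewrite /ball /=.
have {}zz' : ss_dist z z' < e / 5 by exact: zz'.
have h1 := ss_dist_mes_lip h01 hrho z z'; have h2 := ss_dist_mes_lip h01 hrho z' z.
rewrite (ss_dist_sym z' z) in h2.
rewrite /mes_gap !minEle ltr_norml.
by do 2! case: ifPn; rewrite -?ltNge => *; apply/andP; split; lra.
Qed.

End MESChar.

(** * Vanishing integrals and sets of full measure *)

Lemma continuous_borel_measurable (R : realType) (rho : R) (g : sstate rho -> R) :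
  continuous g -> measurable_fun setT (g : borel (sstate rho) -> R).
Proof.
move=> cg; apply: (measurability _ (measurable_realfun.RGenOpens.measurableE R)) => _ [_ [a
  [b ->]] <-].
rewrite setTI; apply: sub_sigma_algebra.
by move/continuousP : cg; apply; exact: interval_open.
Qed.

Lemma probability_zero_set (R : realType) (rho : R) (mu : probability (borel (sstate rho)) R)
    (g : sstate rho -> R) : continuous g -> (forall z, 0 <= g z) ->
  (\int[mu]_z (g z)%:E)%E = 0%E -> mu [set z | g z = 0] = 1%E.
Proof.
move=> cg g0 int0.
have mg := continuous_borel_measurable cg.
have mgE := iffRL (measurable_realfun.measurable_EFinP setT _) mg.
have : (\int[mu]_(z in setT) `|(g z)%:E|)%E = 0%E.
  by rewrite -int0; apply: eq_integral => z _; rewrite gee0_abs // lee_fin.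
move/(ae_eq_integral_abs mu measurableT mgE) => [N [mN N0 sub]].
have mZ : measurable ([set z | g z = 0] : set (borel (sstate rho))).
  rewrite -[X in measurable X]setTI; exact: (mg measurableT [set 0] (measurable_set1 _)).
rewrite -[X in mu X]setCK probability_setC; last exact: measurableC.
suff -> : mu (~` [set z | g z = 0]) = 0%E by rewrite sube0.
apply/eqP; rewrite -measure_le0 -N0; apply: le_measure; rewrite ?inE //.
  exact: measurableC.
by apply: subset_trans sub => z /= gz H; apply: gz; have [] := H I.
Qed.

(** * Profile of a typical state *)

(** [drop (n - l) w ++ take (n - l) w] is the word [w], which starts at [l], re-read from site 0. *)
Lemma card_conf_lt n (l : 'I_n) w k : size w = n -> (k <= n)%N ->
  #|[set i in conf l w | (i < k)%N]| = count id (take k (drop (n - l) w ++ take (n - l) w)).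
Proof.
move=> sw kn; set V := _ ++ _.
have ln := ltn_ord l.
have sV : size V = n by rewrite size_cat size_drop size_take sw; case: ifP; lia.
have VE (i : 'I_n) : nth false V i = nth false w (cw_dist l i).
  rewrite /V nth_cat size_drop sw /cw_dist.
  have iltn := ltn_ord i.
  have -> : (n - (n - l) = l)%N by lia.
  case: ltnP => il; first by rewrite nth_drop addnC modn_small //; lia.
  rewrite nth_take; last by lia.
  by rewrite (_ : (i + (n - l) = i - l + n)%N) ?modnDr ?modn_small //; lia.
rewrite -sum1_card -sum1_count (big_nth false) size_takel ?sV //.
rewrite (eq_bigl (fun i : 'I_n => nth false V i && (i < k)%N)); last first.
  by move=> i; rewrite !inE VE.
rewrite -(big_mkord (fun i => nth false V i && (i < k)%N) (fun=> 1%N)).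
rewrite -(@big_nat_widen _ _ _ 0%N k n (fun i => nth false V i) (fun=> 1%N) kn).
rewrite [LHS]big_nat_cond [RHS]big_nat_cond; apply: eq_bigl => i.
by case: (ltnP i k) => ik; rewrite ?andbF //= nth_take.
Qed.

(** Trades counts from site 0 for prefix counts of [w], the only ones that typicality controls. In
    the second case the range runs past [l], where [w] begins. *)
Lemma count_take_rot n (l k : nat) (w : bitseq) : size w = n -> (l < n)%N -> (k <= n)%N ->
  (count id (take k (drop (n - l) w ++ take (n - l) w)) + count id (take (n - l) w) =
   if (k <= l)%N then count id (take (n - l + k) w)
   else count id w + count id (take (k - l) w))%N.
Proof.
move=> sw ln kn.
have sd : size (drop (n - l) w) = l by rewrite size_drop sw; lia.
case: leqP => kl.
  by rewrite takel_cat ?sd // takeD count_cat addnC.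
rewrite take_cat sd ltnNge (ltnW kl) /= count_cat take_takel; last by lia.
have := cat_take_drop (n - l) w => /(congr1 (count id)); rewrite count_cat => <-.
lia.
Qed.

Section Profile.
Variables (R : realType) (p rho : R).
Hypothesis p01 : 0 < p < 1.
Local Notation h := (p / (1 + p)).

(** A prefix of the boxes with length [s] and [S] particles has [s - S] holes, that is boxes, so
    typicality says that [S] is close to [p * (s - S)]. Solving for [S] gives the density [h]. The
    extra 1 covers a box cut in two and the trailing hole. *)
Lemma count_take_cword (m L : nat) (D : R) (bs : bitseq) (j : nat) :
  size bs = L -> (count id bs < m)%N -> ~~ atypical p L D bs -> 0 <= D ->
  (j <= (m + L).+1)%N ->
  `|(count id (take j (cword m bs)))%:R -
     (h * j%:R + (1 - h) * Num.min j%:R (m - count id bs)%:R)| <= D + 1.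
Proof.
move=> sbs cbs; rewrite /atypical negb_exists => /forallP ty D0 jn.
have /andP[p0 p1] := p01.
have hE : h * (1 + p) = p by rewrite divfK // gt_eqF //; lra.
move: (p / (1 + p)) hE => g gE.
set c := (m - count id bs)%N.
have [jc|jc] := leqP j c.
  rewrite /cword -/c takel_cat ?size_nseq // take_nseq // count_nseq mul1n.
  rewrite minEle ler_nat jc; have -> : j%:R - (g * j%:R + (1 - g) * j%:R) = 0 :> R by ring.
  by rewrite normr0; lra.
rewrite minEle ler_nat leqNgt jc /=.
set s := (j - c)%N; have jE : j%:R = c%:R + s%:R :> R by rewrite -natrD; congr (_%:R);
  rewrite /s; lia.
set S := count id (take s (boxes bs ++ [:: false])).
have -> : count id (take j (cword m bs)) = (c + S)%N.
  rewrite /cword -/c take_cat size_nseq ltnNge (ltnW jc) /= count_cat count_nseq mul1n.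
  by [].
rewrite natrD jE.
have -> : c%:R + S%:R - (g * (c%:R + s%:R) + (1 - g) * c%:R) = S%:R - g * s%:R :> R by ring.
suff H : `|(1 + p) * (S%:R - g * s%:R)| <= D + 1.
  apply: le_trans H; rewrite normrM ler_peMl // ger0_norm; lra.
have -> : (1 + p) * (S%:R - g * s%:R) = S%:R - p * (s%:R - S%:R) by have : g * (1 + p) * s%:R
  = p * s%:R; [rewrite gE|lra].
have sz : (s <= (size (boxes bs)).+1)%N by rewrite size_boxes sbs /s /c; lia.
have [s1|s1] := leqP s (size (boxes bs)).
  have [j' [e [j'L e1 E1 E2]]] := boxes_take s1.
  have j'L' : (j' < L.+1)%N by rewrite -sbs.
  have := ty (Ordinal j'L'); rewrite /= -leNgt -E1 -/S.
  have SE : S = count id (take s (boxes bs)) by rewrite /S takel_cat.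
  rewrite -SE in E1 E2 *.
  have -> : j'%:R = s%:R - S%:R :> R.
    apply/eqP; rewrite eq_sym subr_eq -natrD eqr_nat; apply/eqP; lia.
  rewrite natrD; have e0 : 0 <= e%:R :> R by [].
  have e1' : e%:R <= 1 :> R by rewrite -[1]/(1%:R) ler_nat.
  rewrite !ler_norml => /andP[? ?]; apply/andP; split; lra.
have sE : s = (size (boxes bs)).+1 by lia.
have SE : S = count id bs.
  by rewrite /S sE take_oversize ?size_cat ?addn1 // count_cat count_boxes addn0.
have := ty ord_max; rewrite /= -leNgt -{1}sbs take_size SE.
have -> : s%:R = L%:R + (count id bs)%:R + 1 :> R.
  by rewrite sE size_boxes sbs -natr1 natrD.
rewrite !ler_norml => /andP[? ?]; apply/andP; split; lra.
Qed.

Hypothesis h01 : 0 < h < 1.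
Hypothesis hrho : h < rho < 1.

Lemma tau_star_p : tau_star h rho = rho - p * (1 - rho).
Proof.
have /andP[p0 p1] := p01.
have q0 : 1 + p != 0 by rewrite gt_eqF //; lra.
have -> : tau_star h rho = (rho - h) * (1 + p).
  rewrite /tau_star (_ : 1 - h = (1 + p)^-1) ?invrK //.
  by rewrite -[X in X - _](mulfV q0) -mulrBl addrK mul1r.
by rewrite mulrBl divfK //; ring.
Qed.

Variables (n m : nat) (l : 'I_n) (bs : bitseq) (D : R).
Hypothesis Hn : n = (m + (n - m).-1).+1.
Hypothesis mb : rho * n%:R <= m%:R <= rho * n%:R + 1.
Hypothesis sbs : size bs = (n - m).-1.
Hypothesis cbs : (1 < m - count id bs)%N.
Hypothesis ty : ~~ atypical p (n - m).-1 D bs.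
Hypothesis D0 : 0 <= D.

Let X : R := n%:R.
Let X0 : 0 < X. Proof. by rewrite ltr0n Hn. Qed.
Let A j : R := (count id (take j (cword m bs)))%:R.
Let B := mes_profile h rho.

Let cluster_size : `|(m - count id bs)%:R - X * tau_star h rho| <= D + 3.
Proof.
have := typical_count p01 Hn mb sbs ty; have /andP[m1 m2] := mb.
rewrite natrB; last by clear -cbs; lia.
rewrite tau_star_p -/X; move: m1 m2; rewrite -/X => m1 m2.
by rewrite !ler_norml => /andP[? ?]; apply/andP; split; lra.
Qed.

Let A_approx j : (j <= n)%N -> `|A j - X * B (j%:R / X)| <= 2 * D + 4.
Proof.
move=> jn; have /andP[h0 h1] := h01.
have jX : 0 <= j%:R / X <= 1.
  by rewrite divr_ge0 ?(ltW X0) //= ler_pdivrMr // mul1r ler_nat.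
rewrite /B /mes_profile (covered_unit h01 hrho jX).
have -> : X * (h * (j%:R / X) + (1 - h) * Num.min (j%:R / X) (tau_star h rho)) =
    h * j%:R + (1 - h) * Num.min j%:R (X * tau_star h rho).
  have -> : Num.min j%:R (X * tau_star h rho) = X * Num.min (j%:R / X) (tau_star h rho).
    by rewrite minr_pMr ?(ltW X0) // [X * (j%:R / X)]mulrC divfK ?gt_eqF.
  have -> : h * j%:R = h * (X * (j%:R / X)) by rewrite [X * (j%:R / X)]mulrC divfK ?gt_eqF.
  ring.
have H : (j <= (m + (n - m).-1).+1)%N by rewrite -Hn.
have cm : (count id bs < m)%N by clear -cbs; lia.
have H1 := count_take_cword sbs cm ty D0 H; rewrite -/(A j) in H1.
have H2 : `|Num.min j%:R (m - count id bs)%:R - Num.min j%:R (X * tau_star h rho)| <= D + 3.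
  have D0' := D0; move: cluster_size; rewrite !minEle !ler_norml => /andP[? ?].
  by do 2! case: ifPn; rewrite -?ltNge => *; apply/andP; split; lra.
move: (Num.min _ _) (Num.min _ _) H1 H2 => a b H1 H2.
have H3 : `|(1 - h) * (b - a)| <= D + 3.
  apply: le_trans H2; rewrite normrM ler_piMl // ger0_norm; lra.
by move: H1 H3; rewrite !ler_norml => /andP[? ?] /andP[? ?]; apply/andP; split; lra.
Qed.

Let B_lip (u v e : R) : `|u - v| <= e -> `|X * B u - X * B v| <= X * e.
Proof.
move=> uv; rewrite -mulrBr normrM (gtr0_norm X0) ler_pM2l //.
exact: le_trans (mes_profile_lip h01 hrho _ _) uv.
Qed.

(** The profile skips site 0, whereas prefix counts include it. *)
Let cards_first (eta : config n) K :
  (#|[set i in eta | (1 <= i <= K)%N]| <= #|[set i in eta | (i < K.+1)%N]| <=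
   #|[set i in eta | (1 <= i <= K)%N]| + 1)%N.
Proof.
apply/andP; split.
  by apply: subset_leq_card; apply/fintype.subsetP => i; rewrite !inE => /andP[-> /andP[]].
have n0 : (0 < n)%N by rewrite Hn.
apply: (@leq_trans #|Ordinal n0 |: [set i in eta | (1 <= i <= K)%N]|); last first.
  by rewrite cardsU1 addnC leq_add2l leq_b1.
apply: subset_leq_card; apply/fintype.subsetP => i; rewrite !inE => /andP[-> iK] /=.
by rewrite -val_eqE /=; case: (val i) iK.
Qed.

(** The bound is made of [2 * D + 4] for each of two prefix counts, and 1 each for rounding [y] to a
    site, for site 0 and for rounding [rho * n] to [m]. *)
Let profile_approx y : 0 <= y < 1 ->
  `|profile rho (st m l bs) y - mes_f h rho (l%:R / X) y| <= (4 * D + 11) / X.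
Proof.
move=> /andP[y0 y1].
have cm : (count id bs < m)%N by clear -cbs; lia.
have sw : size (cword m bs) = n by exact: (size_cword_n Hn sbs cm).
have ln := ltn_ord l.
rewrite /profile; have -> : Num.floor y = 0 by apply/eqP; rewrite floor_eq y0.
rewrite subr0 mul0r addr0 -/X.
have /andP[K1 K2] : (Num.truncn (X * y))%:R <= X * y < (Num.truncn (X * y)).+1%:R.
  by apply: truncn_itv; rewrite mulr_ge0 // ltW.
set K := Num.truncn (X * y) in K1 K2 *.
have Kn : (K.+1 <= n)%N.
  by rewrite -(ltr_nat R) (le_lt_trans K1) // gtr_pMr.
have /andP[N1 N2] := cards_first (st m l bs) K.
rewrite -(ler_nat R) in N1; rewrite -(ler_nat R) natrD in N2.
set N1' := #|[set i in _ | (1 <= _ <= K)%N]| in N1 N2 *.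
rewrite (card_conf_lt l sw Kn) in N1 N2.
have := count_take_rot sw ln Kn; move: N1 N2; set N := count id _ => N1 N2 E.
rewrite ler_pdivlMr // -[X in _ * X](gtr0_norm X0) -normrM mulrBl divfK ?gt_eqF //.
rewrite [mes_f _ _ _ _ * X]mulrC /mes_f -/B mulrBr.
have B1 : B (- (l%:R / X)) = B (1 - l%:R / X) - rho.
  by rewrite /B [1 - _]addrC (mes_profileD1 _ h01) addrK.
rewrite B1 mulrBr.
have A0 : `|A (n - l) - X * B (1 - l%:R / X)| <= 2 * D + 4.
  have -> : 1 - l%:R / X = (n - l)%:R / X.
    by rewrite natrB 1?ltnW // mulrBl divff ?gt_eqF.
  exact: A_approx (leq_subr _ _).
have /andP[m1 m2] := mb; rewrite -/X in m1 m2.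
have yK : `|K.+1%:R / X - y| <= 1 / X.
  rewrite ler_pdivlMr // -[X in _ * X](gtr0_norm X0) -normrM mulrBl divfK ?gt_eqF //.
  by rewrite -natr1 in K2 *; rewrite ler_norml; apply/andP; split; lra.
have cardw : count id (cword m bs) = m by rewrite count_cword // ltnW.
move: E; have [Kl|Kl] := leqP K.+1 l => E.
  have H : (n - l + K.+1 <= n)%N by clear -Kl ln; lia.
  have A1 := A_approx H.
  have B2 : `|X * B ((n - l + K.+1)%:R / X) - X * B (y - l%:R / X + 1)| <= X * (1 / X).
    apply: B_lip; apply: le_trans yK; rewrite natrD natrB 1?ltnW // -/X.
    by rewrite mulrDl mulrBl divff ?gt_eqF // le_eqVlt; apply/orP; left; apply/eqP;
      congr `|_|; ring.
  rewrite [B (_ + 1)](mes_profileD1 _ h01) -/B [X * (B _ + rho)]mulrDr in B2.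
  have {}E : N%:R + A (n - l) = A (n - l + K.+1) by rewrite -natrD E.
  rewrite mul1r mulfV ?gt_eqF // in B2.
  move: A0 A1 B2; rewrite !ler_norml => /andP[? ?] /andP[? ?] /andP[? ?]; apply/andP; split;
    lra.
have H : (K.+1 - l <= n)%N by clear -Kn; lia.
have A1 := A_approx H.
have B2 : `|X * B ((K.+1 - l)%:R / X) - X * B (y - l%:R / X)| <= X * (1 / X).
  apply: B_lip; apply: le_trans yK; rewrite natrB 1?ltnW //.
  by rewrite mulrBl le_eqVlt; apply/orP; left; apply/eqP; congr `|_|; ring.
have {}E : N%:R + A (n - l) = m%:R + A (K.+1 - l) by rewrite -!natrD E cardw.
rewrite mul1r mulfV ?gt_eqF // in B2.
by move: A0 A1 B2; rewrite !ler_norml => /andP[? ?] /andP[? ?] /andP[? ?]; apply/andP; split;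
  lra.
Qed.

Lemma ss_dist_scaled (s : 'I_n) :
  ss_dist (scaled rho (st m l bs, s)) (mes h01 hrho (scaled rho (st m l bs, s))) <=
  (6 * D + 19) / X.
Proof.
have cm : (count id bs < m)%N by clear -cbs; lia.
set z := scaled rho _; set z' := mes h01 hrho z.
have [El Es] := cluster_st Hn l sbs cm cbs s.
have zl : ss_l z = l%:R / X by rewrite /= El.
have tauE : ss_tau z = (m - count id bs).-1%:R / X by rewrite /= Es.
have tauT : `|ss_tau z - tau_star h rho| <= (D + 4) / X.
  rewrite tauE ler_pdivlMr // -[X in _ * X](gtr0_norm X0) -normrM mulrBl divfK ?gt_eqF //.
  rewrite [tau_star _ _ * X]mulrC -subn1 natrB; last by clear -cbs; lia.
  by have := cluster_size; rewrite !ler_norml => /andP[? ?]; apply/andP; split; lra.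
have d1 : sup_dist (ss_f z) (ss_f z') <= (4 * D + 11) / X.
  apply: ge_sup; first by case: (sup_dist_has z z').
  move=> _ [x _ <-].
  have /andP[k1 k2] := floor_itv x; rewrite intrD in k2.
  have fx (w : sstate rho) : ss_f w x = ss_f w (x - (Num.floor x)%:~R) + (Num.floor x)%:~R *
    rho.
    by rewrite -ss_fDz subrK.
  rewrite !fx opprD addrACA subrr addr0.
  have := @profile_approx (x - (Num.floor x)%:~R); rewrite -zl; apply.
  by apply/andP; split; lra.
have d2 : circle_dist (ss_l z) (ss_l z') = 0 by exact: circle_distxx.
have d3 : circle_dist (ss_r z) (ss_r z') <= (D + 4) / X.
  apply: le_trans (circle_dist_lb _ _ 0) _; rewrite addr0.
  apply: le_trans tauT; rewrite le_eqVlt; apply/orP; left; apply/eqP; congr `|_|.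
  by rewrite /z' /=; ring.
have -> : (6 * D + 19) / X = (4 * D + 11) / X + (D + 4) / X + (D + 4) / X.
  by rewrite -!mulrDl; congr (_ / _); ring.
rewrite /ss_dist d2 addr0; apply: lerD => //; apply: lerD => //.
Qed.

End Profile.

(** * Vanishing mean distance to equilibrium, and the theorem *)

Section GapLimit.
Variables (R : realType) (p lambda rho : R).
Hypothesis p01 : 0 < p < 1.
Hypothesis lambda0 : 0 < lambda.
Hypothesis prho : p * (1 - rho) < rho.
Hypothesis rho2 : rho < 1 / 2.
Hypothesis h01 : 0 < p / (1 + p) < 1.
Hypothesis hrho : p / (1 + p) < rho < 1.

Lemma mes_gap_limit (pi : forall n, config n * 'I_n -> R) :
  (\forall n \near \oo, tasep_stationary_ext p lambda rho (pi n)) ->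
  (fun n => \sum_z pi n z * mes_gap h01 hrho (scaled rho z)) @ \oo --> (0 : R).
Proof.
move=> H; apply/cvgrPdist_le => eps eps0.
have /andP[p0 p1] := p01.
have rho0 : 0 < rho by case/andP: hrho => h1 _; case/andP: h01 => h2 _; exact: lt_trans h1.
(* Makes the term [6 * D / n] of [ss_dist_scaled] at most [eps / 4]; the remaining [19 / n] gets
   another [eps / 4]. *)
pose delta := Num.min 2 (eps / 24).
have delta02 : 0 < delta <= 2 by rewrite /delta lt_min ge_min lexx ltr0n divr_gt0.
have delta_eps : delta <= eps / 24 by rewrite ge_min lexx orbT.
have eps2 : 0 < eps / 2 by rewrite divr_gt0.
have sg : \forall n \near \oo,
    stationary_good p rho lambda (fun eta => \sum_s pi n (eta, s)).
  by apply: filterS2 H (tasep_stationary_ext_good lambda p01 prho rho2) => n h1; apply.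
have conc : \forall n \near \oo, \sum_eta (\sum_s pi n (eta, s)) *
    (untypical p (delta * n%:R) (nparticles rho n) eta)%:R <= eps / 2.
  by apply: filterS2 sg (concentration p01 prho rho2 lambda0 delta02 eps2) => n h1; apply.
near=> n.
have [m2 L0 Hn] : let m := nparticles rho n in
  [/\ (1 < m)%N, (0 < (n - m).-1)%N & n = (m + (n - m).-1).+1].
  by near: n; exact: (near_dims p01 prho rho2).
have [pi0 pi1 _ _] : tasep_stationary_ext p lambda rho (pi n) by near: n.
have cn : \sum_eta (\sum_s pi n (eta, s)) *
    (untypical p (delta * n%:R) (nparticles rho n) eta)%:R <= eps / 2 by near: n.
have X1 : 1 <= n%:R :> R by near: n; exact: nbhs_infty_ger.
have XC : 19 / (eps / 4) <= n%:R :> R by near: n; exact: nbhs_infty_ger.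
rewrite ler_pdivrMr ?divr_gt0 // in XC.
have X0 : 0 < n%:R :> R by lra.
have mb := nparticles_bounds n (ltW rho0).
set m := nparticles rho n in m2 L0 Hn cn mb.
have mb' : rho * n%:R <= m%:R <= rho * n%:R + 1.
  by case/andP: mb => -> /ltW.
have pt (z : config n * 'I_n) : mes_gap h01 hrho (scaled rho z) <=
    eps / 2 + (untypical p (delta * n%:R) m z.1)%:R.
  have [_|] := boolP (untypical _ _ _ _).
    by apply: le_trans (mes_gap_le1 _ _ _) _; rewrite lerDr ltW.
  rewrite negbK addr0 => /existsP[l /existsP[bs /and3P[c2 ty /eqP zE]]].
  have D0 : 0 <= delta * n%:R by case/andP: delta02 => d0 _; rewrite mulr_ge0 // ltW.
  have := ss_dist_scaled p01 h01 hrho l Hn mb' (size_tuple bs) c2 ty D0 z.2.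
  rewrite -zE -surjective_pairing => H1.
  apply: le_trans (_ : _ <= ss_dist (scaled rho z) (mes h01 hrho (scaled rho z))) _.
    by rewrite ge_min lexx orbT.
  apply: le_trans H1 _; rewrite ler_pdivrMr //.
  have : delta * n%:R <= eps / 24 * n%:R by rewrite ler_wpM2r // ltW.
  lra.
rewrite sub0r normrN ger0_norm; last first.
  by apply: sumr_ge0 => z _; rewrite mulr_ge0 ?mes_gap_ge0.
apply: le_trans (_ : _ <= \sum_z pi n z * (eps / 2 + (untypical p (delta * n%:R) m z.1)%:R)) _.
  by apply: ler_sum => z _; exact: ler_wpM2l (pi0 z) _ _ (pt z).
under eq_bigr do rewrite mulrDr.
rewrite big_split /= -mulr_suml pi1 mul1r.
suff -> : \sum_z pi n z * (untypical p (delta * n%:R) m z.1)%:R =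
    \sum_eta (\sum_s pi n (eta, s)) * (untypical p (delta * n%:R) m eta)%:R by lra.
under [RHS]eq_bigr do rewrite mulr_suml.
by rewrite pair_big; apply: eq_bigr => -[].
Unshelve. all: end_near. Qed.

End GapLimit.

Lemma subsequence_ge (k : nat -> nat) : {homo k : i j / (i < j)%N} -> forall j, (j <= k j)%N.
Proof. by move=> kk; elim=> // j IH; exact: leq_ltn_trans IH (kk _ _ (ltnSn j)). Qed.

Theorem theorem12 (R : realType) (p h lambda rho : R)
    (hp : 0 < p <= 1) (hh : h = p / (1 + p)) (hlambda : 0 < lambda)
    (hrho : h < rho < 1 / 2) :
  (forall (pi : forall n, config n * 'I_n -> R) (k : nat -> nat)
      (mu : probability (borel (sstate rho)) R),
    (\forall n \near \oo, tasep_stationary_ext p lambda rho (pi n)) ->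
    {homo k : i j / (i < j)%N} ->
    weak_limit pi k mu ->
    mu (main_equilibrium h rho) = 1%E)
  /\
  (forall nu : forall n, config n -> R,
    (\forall n \near \oo, tasep_stationary p lambda rho (nu n)) ->
    flux p lambda (nu n) @[n --> \oo] --> (1 - tau_star h rho) * h)
  /\
  (1 - tau_star h rho) * h = p * (1 - rho).
Proof.
subst h.
have /andP[p0 p1] := hp; have /andP[hr1 hr2] := hrho.
have q0 : 0 < 1 + p by lra.
(* [p = 1] would give [h = 1 / 2], leaving no room for [rho] below [1 / 2]. *)
have p01 : 0 < p < 1.
  have : p / (1 + p) < 1 / 2 by exact: lt_trans hr2.
  by rewrite ltr_pdivrMr // p0 /=; lra.
have prho : p * (1 - rho) < rho by move: hr1; rewrite ltr_pdivrMr //; lra.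
have h01 : 0 < p / (1 + p) < 1 by rewrite divr_gt0 // ltr_pdivrMr //; lra.
have hrho1 : p / (1 + p) < rho < 1 by rewrite hr1; lra.
have E : (1 - tau_star (p / (1 + p)) rho) * (p / (1 + p)) = p * (1 - rho).
  rewrite (tau_star_p rho p01).
  have -> : 1 - (rho - p * (1 - rho)) = (1 + p) * (1 - rho) by ring.
  by rewrite mulrAC [X in X * _](mulrC (1 + p)) divfK ?gt_eqF.
split; last split => //; last first.
  by move=> nu Hnu; rewrite E; exact: flux_limit.
move=> pi k mu Hpi kk wl.
have gc := mes_gap_continuous (h01 := h01) (hrho := hrho1).
have lim0 := mes_gap_limit p01 hlambda prho hr2 h01 hrho1 Hpi.
have int0 : (\int[mu]_z (mes_gap h01 hrho1 z)%:E)%E = 0%E.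
  have gb : exists C : R, forall z : sstate rho, `|mes_gap h01 hrho1 z| <= C.
    by exists 1 => z; rewrite ger0_norm ?mes_gap_ge0 ?mes_gap_le1.
  have l1 := wl _ gc gb.
  apply: (cvg_unique _ l1) => //.
  apply: cvg_EFin; first exact: nearW.
  apply/cvgrPdist_le => eps eps0; have /cvgrPdist_le/(_ eps eps0)[N _ HN] := lim0.
  by exists N => // j /= Nj; apply: HN; exact: leq_trans Nj (subsequence_ge kk j).
rewrite -(probability_zero_set gc (mes_gap_ge0 _ _) int0); congr (mu _).
by apply/seteqP; split=> z /=; rewrite (mes_gap_eq0 h01 hrho1 z).
Qed.
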